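(* Let $\dot x=f(x)$, $x\in\mathbb{R}^n$, be a polynomial system with flow $\Phi^t$, let $K\subset\mathbb{R}^n$ be a compact set and $\mu$ a probability measure on $K$, and suppose that conditions (A1), (A2), (A3) listed in the context hold. Then there exists an invariant set $X_0\subset K$ with $\mu(X_0)=1$ such that for every $x\in X_0$ and every affine hyperplane $H\subset\mathbb{R}^n$, $$\lim_{\varepsilon\to0}\ \limsup_{T\to\infty}\ \frac1T\int_0^T\mathbf 1_{U_\varepsilon(H)}(\Phi^t x)\,dt=0,$$ where $U_\varepsilon(H)=\{y\in K:\operatorname{dist}(y,H)<\varepsilon\}$.
   Context: Setting. $f=f_\xi:\mathbb{R}^n\to\mathbb{R}^n$ is a vector field with polynomial components $f_i(x)=\sum_j\xi_{ij}p_{ij}(x)$ (finite sums), where the $p_{ij}$ are monomials and $\xi=(\xi_{ij})\in\Xi\subset\mathbb{R}^m$ is a fixed parameter; $\Phi^t$ denotes the flow of $\dot x=f(x)$. For a vector-valued polynomial map $g$, $L_f g(x)=Dg(x)f(x)$ is the (componentwise) Lie derivative along $f$, and $L_f^k$ is its $k$-fold iterate ($L_f^0 g=g$). Conditions: (A1) $K\subset\mathbb{R}^n$ is compact and invariant: for points of $K$ the flow is defined for all $t\in\mathbb{R}$ and $\Phi^t(K)\subset K$ for all $t\in\mathbb{R}$. (A2) $\mu$ is a $\Phi^t$-invariant probability measure on $K$ that is absolutely continuous with respect to Lebesgue measure, $d\mu=\rho(x)\,dx$, with constants $c,C$ such that $0<c\le\rho(x)\le C<\infty$ on $K$. (A3)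 For the $n\times n$ matrix $M(x)=[f(x)\mid L_f f(x)\mid\dots\mid L_f^{n-1}f(x)]$ (columns) and the polynomial $Q(x)=\det M(x)$, there exists a point $x_*\in K$ with $Q(x_* )\neq0$. A set $X_0\subset K$ is invariant if $\Phi^t(X_0)\subset X_0$ for all $t\in\mathbb{R}$. $\operatorname{dist}$ is Euclidean distance and $\mathbf 1_A$ is the indicator function of $A$. *)

(* Defs.v *)
From HB Require Import structures.
From mathcomp Require Import all_boot all_order all_algebra.
From mathcomp.multinomials Require mpoly.
Import -(notations) mpoly.
From mathcomp Require Import all_classical all_reals all_analysis.
From mathcomp Require Import lra.

Set Implicit Arguments.
Unset Strict Implicit.
Unset Printing Implicit Defensive.

Import Order.TTheory GRing.Theory Num.Theory.
Import numFieldNormedType.Exports.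

Local Open Scope classical_set_scope.
Local Open Scope ring_scope.

(* Matrices, in particular 'rV[R]_n, carry their Borel sigma-algebra. *)
HB.instance Definition _ (R : realType) (m n : nat) :=
  @isMeasurable.Build (sigma_display (@open 'M[R]_(m, n))) 'M[R]_(m, n)
    <<s @open 'M[R]_(m, n) >> (@sigma_algebra0 _ setT (@open 'M[R]_(m, n)))
    (@sigma_algebraC _ (@open 'M[R]_(m, n)))
    (@sigma_algebra_bigcup _ setT (@open 'M[R]_(m, n))).

Lemma measurable_fun_rV (R : realType) d (T : measurableType d) (n : nat)
    (f : T -> 'rV[R]_n) :
  (forall i, measurable_fun [set: T] (fun x => f x 0 i)) ->
  measurable_fun [set: T] f.
Proof.
move=> mf; apply: (measurability (@open 'rV[R]_n)) => //.
move=> _ [U oU <-]; rewrite setTI.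
pose box (c : 'rV[rat]_n * rat) : set 'rV[R]_n :=
  [set y | forall i, y 0 i \in `](ratr (c.1 0 i - c.2)), (ratr (c.1 0 i + c.2))[].
have -> : f @^-1` U =
    \bigcup_c (if `[< box c `<=` U >] then f @^-1` box c else set0).
  apply/seteqP; split => [x /= Ux|x [c _]]; last first.
    by case: asboolP => // cU /= fc; exact: cU.
  have /nbhs_ballP[e /= e0 eU] := open_nbhs_nbhs (conj oU Ux).
  have [q q0 qe] : exists2 q : rat, 0 < q & ratr q *+ 2 < e.
    have /rat_in_itvoo[q] : 0 < e / 2 by rewrite divr_gt0.
    rewrite in_itv /= => /andP[q0 qe]; exists q; first by rewrite -(@ltr0q R).
    by rewrite -mulr_natr -ltr_pdivlMr.
  have H i : exists c : rat, f x 0 i \in `](ratr (c - q)), (ratr (c + q))[.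
    have /rat_in_itvoo[c] : f x 0 i - ratr q < f x 0 i + ratr q.
      by rewrite ltrBlDr -addrA ltrDl addr_gt0// ltr0q.
    rewrite in_itv /= => /andP[c1 c2]; exists c.
    by rewrite in_itv /= !(rmorphD, rmorphN) /= ltrBlDr c2 -ltrBlDr c1.
  have [c cP] := choice H.
  exists (\row_i c i, q) => //=; case: asboolP => [_|[]].
    by move=> i /=; rewrite mxE.
  move=> y /= yb; apply: eU; split => // i j; rewrite ord1.
  have := yb j; have := cP j; rewrite !mxE !in_itv /=.
  rewrite !(rmorphD, rmorphN) /= => /andP[a1 a2] /andP[b1 b2].
  by rewrite /ball /= ltr_norml; apply/andP; split; lra.
apply: countable_bigcupT_measurable => [|c]; first exact: countableP.
case: asboolP => // _; have -> : f @^-1` box c =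
    \bigcap_(i in [set: 'I_n]) ((fun x => f x 0 i) @^-1`
      `](ratr (c.1 0 i - c.2)), (ratr (c.1 0 i + c.2))[).
  by apply/seteqP; split => [x fx i _|x fx i]; apply: fx.
apply: fin_bigcap_measurable => // i _.
by rewrite -[X in measurable X]setTI; exact: mf.
Qed.

Definition rV_cons (R : realType) (n : nat) (p : R * 'rV[R]_n) : 'rV[R]_n.+1 :=
  row_mx p.1%:M p.2.

Lemma measurable_rV_coord (R : realType) (n : nat) (i : 'I_n) :
  measurable_fun [set: 'rV[R]_n] (fun y : 'rV[R]_n => y 0 i).
Proof.
apply: (measurability (@measurable_realfun.RGenOpens.G R)); first exact: measurable_realfun.RGenOpens.measurableE.
move=> _ [_ [a [b ->]] <-]; rewrite setTI; apply: sub_sigma_algebra => /=.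
by apply: open_comp => [y _|]; [exact: coord_continuous | exact: interval_open].
Qed.

Lemma rV_cons0 (R : realType) (n : nat) (p : R * 'rV[R]_n) :
  rV_cons p 0 ord0 = p.1.
Proof.
rewrite /rV_cons (_ : ord0 = lshift n (@ord0 0)); last exact/val_inj.
by rewrite [LHS]row_mxEl mxE eqxx.
Qed.

Lemma rV_consS (R : realType) (n : nat) (p : R * 'rV[R]_n) (i : 'I_n) :
  rV_cons p 0 (lift ord0 i) = p.2 0 i.
Proof.
rewrite /rV_cons (_ : lift ord0 i = rshift 1 i); last exact/val_inj.
by rewrite [LHS]row_mxEr.
Qed.

Lemma measurable_rV_cons (R : realType) (n : nat) :
  measurable_fun [set: R * 'rV[R]_n] (@rV_cons R n).
Proof.
apply: measurable_fun_rV => i; case: (unliftP ord0 i) => [j ->|->].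
  under eq_fun do rewrite rV_consS.
  exact: (measurableT_comp (@measurable_rV_coord R n j)).
by under eq_fun do rewrite rV_cons0; exact: measurable_fst.
Qed.

Section lebesgue_rV_succ.
Variables (R : realType) (n : nat) (m : {measure set 'rV[R]_n -> \bar R}).

Definition lebesgue_rV_succ : set 'rV[R]_n.+1 -> \bar R :=
  pushforward (lebesgue_measure \x^ m)%E (@rV_cons R n).

HB.instance Definition _ := Measure.copy lebesgue_rV_succ
  (measure_function_pushforward__canonical__measure_function_Measure
    (lebesgue_measure \x^ m)%E (@measurable_rV_cons R n)).

End lebesgue_rV_succ.

Fixpoint lebesgue_rV (R : realType) (n : nat) : {measure set 'rV[R]_n -> \bar R} :=
  if n is n'.+1 then lebesgue_rV_succ (lebesgue_rV R n') else dirac (0 : 'rV[R]_0).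

Lemma measurable_rV_box (R : realType) (n : nat) (A : 'I_n -> set R) :
  (forall i, measurable (A i)) ->
  measurable [set y : 'rV[R]_n | forall i, A i (y 0 i)].
Proof.
move=> mA; rewrite (_ : [set _ | _] =
    \bigcap_(i in [set: 'I_n]) ((fun y : 'rV[R]_n => y 0 i) @^-1` A i)).
  apply: fin_bigcap_measurable => // i _.
  by rewrite -[X in measurable X]setTI; exact: measurable_rV_coord.
by apply/seteqP; split => [y yA i _|y yA i]; exact: yA.
Qed.

Lemma lebesgue_rV_box (R : realType) (n : nat) (A : 'I_n -> set R) :
  (forall i, measurable (A i)) ->
  lebesgue_rV R n [set y | forall i, A i (y 0 i)] =
  (\prod_(i < n) lebesgue_measure (A i))%E.
Proof.
elim: n A => [|n IH] A mA.
  by rewrite big_ord0 /= diracE mem_set// => -[].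
rewrite big_ord_recl -IH; last by move=> i; exact: mA.
have mA' := measurable_rV_box (fun i => mA (lift ord0 i)).
rewrite -product_measure2E; [|exact: mA|exact: mA'].
rewrite /= /lebesgue_rV_succ /pushforward; congr (_ _).
apply/seteqP; split => -[x y] /= => [xyA|[xA yA] i].
  split=> [|i]; first by have := xyA ord0; rewrite rV_cons0.
  by have := xyA (lift ord0 i); rewrite rV_consS.
by case: (unliftP ord0 i) => [j|] ->; rewrite ?rV_cons0 ?rV_consS//; exact: yA.
Qed.

(* The field with components sum_j xi_ij p_ij, for monomials p_ij and fixed
   parameters xi_ij, is given by the polynomials [F i] with these terms. *)
Definition vector_field (R : realType) (n : nat) (F : 'I_n -> mpoly n R)
    (x : 'rV[R]_n) : 'rV[R]_n :=
  \row_i meval (x 0) (F i).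

Definition lie_derivative (R : realType) (n : nat) (F G : 'I_n -> mpoly n R)
    : 'I_n -> mpoly n R :=
  fun i => \sum_(k < n) mderiv k (G i) * F k.

Definition lie_matrix (R : realType) (n : nat) (F : 'I_n -> mpoly n R)
    : 'M[mpoly n R]_n :=
  \matrix_(i, j) iter j (lie_derivative F) F i.

Definition lie_det (R : realType) (n : nat) (F : 'I_n -> mpoly n R)
    : mpoly n R :=
  \det (lie_matrix F).

Definition is_flow_value (R : realType) (n : nat) (f : 'rV[R]_n -> 'rV[R]_n)
    (t : R) (x y : 'rV[R]_n) : Prop :=
  exists (a b : R) (g : R -> 'rV[R]_n),
    [/\ 0 \in `]a, b[, t \in `]a, b[,
        (forall s, s \in `]a, b[ -> is_derive s 1 g (f (g s))),
        g 0 = x & g t = y].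

Definition flow_defined (R : realType) (n : nat) (f : 'rV[R]_n -> 'rV[R]_n)
    (t : R) (x : 'rV[R]_n) : Prop :=
  exists y, is_flow_value f t x y.

(* The value is unique for locally Lipschitz [f]; it is the junk value [x] where
   the solution starting at [x] does not exist up to time [t]. *)
Definition flow (R : realType) (n : nat) (f : 'rV[R]_n -> 'rV[R]_n)
    (t : R) (x : 'rV[R]_n) : 'rV[R]_n :=
  xget x (is_flow_value f t x).

Definition flow_invariant (R : realType) (n : nat) (f : 'rV[R]_n -> 'rV[R]_n)
    (A : set 'rV[R]_n) : Prop :=
  forall t : R, flow f t @` A `<=` A.

Definition compact_invariant (R : realType) (n : nat) (f : 'rV[R]_n -> 'rV[R]_n)
    (K : set 'rV[R]_n) : Prop :=
  [/\ compact K, (forall x t, K x -> flow_defined f t x) & flow_invariant f K].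

(* A probability measure on K is a Borel probability measure on R^n giving K
   full mass.  The preimage is cut with K since the flow need not be defined
   outside of K. *)
Definition invariant_measure (R : realType) (n : nat) (f : 'rV[R]_n -> 'rV[R]_n)
    (K : set 'rV[R]_n) (mu : probability 'rV[R]_n R) : Prop :=
  mu K = 1%E /\
  forall (t : R) (A : set 'rV[R]_n), measurable A ->
    mu (K `&` flow f t @^-1` A) = mu A.

Definition bounded_density (R : realType) (n : nat) (K : set 'rV[R]_n)
    (mu : probability 'rV[R]_n R) : Prop :=
  exists (rho : 'rV[R]_n -> R) (c C : R),
    [/\ 0 < c, measurable_fun K rho,
        (forall x, K x -> c <= rho x <= C) &
        forall A : set 'rV[R]_n, measurable A ->
          mu A = (\int[lebesgue_rV R n]_(x in A `&` K) (rho x)%:E)%E].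

Definition is_affine_hyperplane (R : realType) (n : nat) (H : set 'rV[R]_n) : Prop :=
  exists (a : 'rV[R]_n) (b : R),
    a != 0 /\ H = [set y | \sum_(i < n) a 0 i * y 0 i = b].

(* The library norm on 'rV[R]_n is the sup norm. *)
Definition euclidean_norm (R : realType) (n : nat) (x : 'rV[R]_n) : R :=
  Num.sqrt (\sum_(i < n) x 0 i ^+ 2).

Definition euclidean_dist (R : realType) (n : nat) (y : 'rV[R]_n) (H : set 'rV[R]_n) : R :=
  inf [set euclidean_norm (y - z) | z in H].

Definition neighborhood_in (R : realType) (n : nat) (K H : set 'rV[R]_n) (e : R)
    : set 'rV[R]_n :=
  [set y | K y /\ euclidean_dist y H < e].

Definition time_average (R : realType) (n : nat) (f : 'rV[R]_n -> 'rV[R]_n)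
    (x : 'rV[R]_n) (A : set 'rV[R]_n) (T : R) : \bar R :=
  (T^-1%:E * \int[lebesgue_measure]_(t in `[0%R, T]) (\1_A (flow f t x))%:E)%E.

(* Main.v *)
(** Let Q = det [f | L_f f | ... | L_f^(n-1) f].  Along an orbit t |-> Phi^t x put
    h(t) = a . Phi^t x - b, so that h^(k)(t) = a . L_f^(k-1) f (Phi^t x) for k >= 1.
    Where |Q| >= delta > 0 on the compact K, Cramer's rule bounds one of h', ...,
    h^(n) away from 0, uniformly in time, and a function with |h^(k)| >= eta on an
    interval is smaller than eps only on a set of measure o(1) as eps -> 0.  So an
    orbit that is rarely in {|Q| < delta} is rarely near a hyperplane.

    The zero set of Q is Lebesgue null, hence mu {|Q| <= delta} -> 0, and the
    maximal ergodic inequality makes the orbit of almost every point rarely visit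
    {|Q| <= c / m} at the times j / m, for a suitable m.  Since |Q| varies by at
    most L / m between consecutive times, this discrete condition, asked for all
    c, is invariant under the whole flow; only the inequality for the single maps
    Phi^(1/m) is needed, and no joint measurability of the flow. *)

Require Import Defs.
From mathcomp Require Import all_boot all_order all_algebra.
From mathcomp.multinomials Require mpoly.
Import -(notations) mpoly.
From mathcomp Require Import all_classical all_reals all_analysis.
From mathcomp Require Import measurable_realfun ring lra.

Set Implicit Arguments.
Unset Strict Implicit.
Unset Printing Implicit Defensive.

Import Order.TTheory GRing.Theory Num.Theory.
Import numFieldNormedType.Exports.

Local Open Scope classical_set_scope.
Local Open Scope ring_scope.

(** * Polynomial functions and Lie derivatives *)

(** Constants and variables generate the polynomials as a ring. Lipschitz bounds, measurability and
    the chain rule all pass through sums and products, so each is checked on generators only. *)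
Lemma mpoly_ring_ind (R : comNzRingType) (n : nat) (S : mpoly n R -> Prop) :
  (forall c, S (mpolyC n c)) -> (forall i, S (mpolyX R (mnm1 i))) ->
  (forall p q, S p -> S q -> S (p + q)) ->
  (forall p q, S p -> S q -> S (p * q)) -> forall p, S p.
Proof.
move=> SC SX SD SM; apply: mpolyind => [|c m p _ _ Sp].
  by rewrite -(mpolyC0 n R); exact: SC.
apply: (SD) => //; rewrite -mul_mpolyC; apply: (SM); first exact: SC.
rewrite mpolyXE_id; elim/big_ind : _ => [||i _]; [|exact: SM|].
  by rewrite -(mpolyC1 n R); exact: SC.
elim: (m i) => [|k IHk]; first by rewrite expr0 -(mpolyC1 n R); exact: SC.
by rewrite exprS; exact: SM.
Qed.

(** The scalar operator that [lie_derivative] applies to each component; it also acts on affine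
    functions and on [lie_det]. *)
Definition lie_poly (R : comNzRingType) (n : nat) (F : 'I_n -> mpoly n R)
    (p : mpoly n R) : mpoly n R :=
  \sum_(k < n) mderiv k p * F k.

Section lie_poly_theory.
Variables (R : comNzRingType) (n : nat) (F : 'I_n -> mpoly n R).
Implicit Types p q : mpoly n R.

Lemma lie_polyD p q : lie_poly F (p + q) = lie_poly F p + lie_poly F q.
Proof.
by rewrite /lie_poly -big_split; apply: eq_bigr => k _; rewrite mderivD mulrDl.
Qed.

Lemma lie_polyM p q :
  lie_poly F (p * q) = p * lie_poly F q + q * lie_poly F p.
Proof.
rewrite /lie_poly !mulr_sumr -big_split; apply: eq_bigr => k _.
by rewrite mderivM /=; ring.
Qed.

Lemma lie_polyC c : lie_poly F (mpolyC n c) = 0.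
Proof. by rewrite /lie_poly big1// => k _; rewrite mderivC mul0r. Qed.

Lemma lie_polyX i : lie_poly F (mpolyX R (mnm1 i)) = F i.
Proof.
rewrite /lie_poly (bigD1 i)//= big1 => [|k ki].
  rewrite mderivX mnm1E eqxx scale1r -[X in mnm_sub X _]add0m addmK.
  by rewrite mpolyX0 mul1r addr0.
by rewrite mderivX mnm1E eq_sym (negPf ki) scale0r mul0r.
Qed.

End lie_poly_theory.

Definition in_box (R : realType) (n : nat) (r : R) (x : 'rV[R]_n) :=
  forall i, `|x 0 i| <= r.

Section polynomial_functions.
Variables (R : realType) (n : nat).
Implicit Types (p q : mpoly n R) (x y : 'rV[R]_n) (r : R).

(** The bound and the Lipschitz estimate go through the induction together, since the estimate for a
    product uses the bounds on both factors. *)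
Lemma meval_lipschitz p r : exists2 C, 0 <= C & forall x y,
  in_box r x -> in_box r y ->
  `|meval (x 0) p| <= C /\
  `|meval (x 0) p - meval (y 0) p| <= C * \sum_i `|x 0 i - y 0 i|.
Proof.
elim/mpoly_ring_ind: p => [c|i|p q [A A0 IHp] [B B0 IHq]|p q [A A0 IHp] [B B0 IHq]].
- exists `|c| => // x y _ _; rewrite !mevalC subrr normr0; split=> //.
  by rewrite mulr_ge0// sumr_ge0.
- exists (1 + `|r|); first by rewrite addr_ge0.
  move=> x y xr yr; rewrite !mevalXU; split.
    by rewrite (le_trans (xr i))// (le_trans (ler_norm r))// lerDr.
  rewrite (bigD1 i)//= -[leLHS]mul1r ler_pM// ?lerDl//.
  by rewrite sumr_ge0.
- exists (A + B) => [|x y xr yr]; first exact: addr_ge0.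
  have [pA pl] := IHp x y xr yr; have [qB ql] := IHq x y xr yr.
  rewrite !mevalD; split; first by rewrite (le_trans (ler_normD _ _))// lerD.
  by rewrite opprD addrACA (le_trans (ler_normD _ _))// mulrDl lerD.
- exists (A * B *+ 2) => [|x y xr yr]; first by rewrite mulrn_wge0// mulr_ge0.
  have [pA pl] := IHp x y xr yr; have [qB ql] := IHq x y xr yr.
  have [pA' _] := IHp y x yr xr.
  rewrite !mevalM; split.
    rewrite normrM (le_trans (ler_pM _ _ pA qB))// mulr2n lerDl mulr_ge0//.
  rewrite (_ : _ - _ = (meval (x 0) p - meval (y 0) p) * meval (x 0) q +
    meval (y 0) p * (meval (x 0) q - meval (y 0) q)); last by ring.
  rewrite (le_trans (ler_normD _ _))// !normrM mulr2n mulrDl lerD//.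
    by rewrite mulrAC ler_pM.
  by rewrite -mulrA ler_pM.
Qed.

Lemma meval_lipschitz_fin (m : nat) (P : 'I_m -> mpoly n R) r :
  exists2 C, 0 <= C & forall i x y, in_box r x -> in_box r y ->
    `|meval (x 0) (P i)| <= C /\
    `|meval (x 0) (P i) - meval (y 0) (P i)| <= C * \sum_j `|x 0 j - y 0 j|.
Proof.
have [C C0 CP] := fin_all_exists2 (fun i => meval_lipschitz (P i) r).
exists (\sum_i C i) => [|i x y xr yr]; first by rewrite sumr_ge0.
have [Px Pxy] := CP i x y xr yr.
have CC : C i <= \sum_i C i by rewrite (bigD1 i)//= lerDl sumr_ge0.
split; first exact: le_trans Px CC.
by rewrite (le_trans Pxy)// ler_wpM2r// sumr_ge0.
Qed.

Lemma measurable_meval p : measurable_fun [set: 'rV[R]_n] (fun x => meval (x 0) p).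
Proof.
elim/mpoly_ring_ind: p => [c|i|p q mp mq|p q mp mq].
- by under eq_fun do rewrite mevalC; exact: measurable_cst.
- by under eq_fun do rewrite mevalXU; exact: measurable_rV_coord.
- by under eq_fun do rewrite mevalD; exact: measurable_funD.
- by under eq_fun do rewrite mevalM; exact: measurable_funM.
Qed.

(** Chain rule along a solution: both sides obey the Leibniz rule and agree on the variables. *)
Lemma is_derive_meval (F : 'I_n -> mpoly n R) (u : R -> 'rV[R]_n) (t : R) p :
  (forall i, is_derive t 1 (fun s => u s 0 i) (meval (u t 0) (F i))) ->
  is_derive t 1 (fun s => meval (u s 0) p) (meval (u t 0) (lie_poly F p)).
Proof.
move=> du; elim/mpoly_ring_ind: p => [c|i|p q dp dq|p q dp dq].
- under eq_fun do rewrite mevalC.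
  by rewrite lie_polyC meval0; exact: is_derive_cst.
- by under eq_fun do rewrite mevalXU; rewrite lie_polyX.
- under eq_fun do rewrite mevalD.
  by rewrite lie_polyD mevalD; exact: is_deriveD.
- under eq_fun do rewrite mevalM.
  by rewrite lie_polyM mevalD !mevalM; exact: is_deriveM.
Qed.

End polynomial_functions.

(** * Zero sets of polynomials *)

(** Reads a polynomial as univariate in the first coordinate, with coefficients in the others, to
    prepare Fubini. *)
Lemma meval_rV_cons (R : realType) (n : nat) (p : mpoly n.+1 R) :
  exists q : {poly mpoly n R}, forall (t : R) (y : 'rV[R]_n),
    meval (rV_cons (t, y) 0) p = (map_poly (meval (y 0)) q).[t].
Proof.
elim/mpoly_ring_ind: p => [c|i|p1 p2 [q1 e1] [q2 e2]|p1 p2 [q1 e1] [q2 e2]].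
- by exists (mpolyC n c)%:P => t y; rewrite map_polyC /= hornerC !mevalC.
- case: (unliftP ord0 i) => [j ->|->].
    exists (mpolyX R (mnm1 j))%:P => t y.
    by rewrite map_polyC /= hornerC !mevalXU rV_consS.
  by exists 'X => t y; rewrite map_polyX hornerX mevalXU rV_cons0.
- by exists (q1 + q2) => t y; rewrite mevalD e1 e2 rmorphD hornerD.
- by exists (q1 * q2) => t y; rewrite mevalM e1 e2 rmorphM hornerM.
Qed.

Lemma measurable_zeros_meval (R : realType) (n : nat) (p : mpoly n R) :
  measurable [set x : 'rV[R]_n | meval (x 0) p = 0].
Proof.
rewrite (_ : [set _ | _] = (fun x : 'rV[R]_n => meval (x 0) p) @^-1` [set 0])//.
by rewrite -[X in measurable X]setTI; exact: measurable_meval.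
Qed.

Lemma lebesgue_zeros_meval (R : realType) (n : nat) (p : mpoly n R) :
  (exists x : 'rV[R]_n, meval (x 0) p != 0) ->
  lebesgue_rV R n [set x | meval (x 0) p = 0] = 0%E.
Proof.
elim: n p => [|n IHn] p [x px].
  have p0 : [set y : 'rV[R]_0 | meval (y 0) p = 0] = set0.
    rewrite -subset0 => y /=.
    by rewrite (_ : y = x); [exact/eqP|rewrite [x]thinmx0; exact: thinmx0].
  exact: etrans (congr1 _ p0) (measure0 _).
have [q qE] := meval_rV_cons p.
have [t0 [y0 xE]] : exists (t : R) (y : 'rV[R]_n), x = rV_cons (t, y).
  exists (x 0 ord0), (\row_j x 0 (lift ord0 j)); apply/rowP => i.
  by case: (unliftP ord0 i) => [j|] ->; [rewrite rV_consS mxE|rewrite rV_cons0].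
have [k qk] : exists k, meval (y0 0) q`_k != 0.
  move: px; rewrite xE qE => q0; apply: contrapT => /forallNP qk.
  move/eqP: q0; apply; rewrite (_ : map_poly _ q = 0) ?horner0//.
  apply/polyP => k; rewrite coef_map coef0 /=.
  by have /negP := qk k; rewrite negbK => /eqP.
have N0 := IHn q`_k (ex_intro _ y0 qk).
have mN := measurable_zeros_meval q`_k.
set N := [set y | _] in N0 mN.
set A := [set x | _].
have mA : measurable (@rV_cons R n @^-1` A).
  rewrite -[X in measurable X]setTI; apply: measurable_rV_cons => //.
  exact: measurable_zeros_meval.
(* By definition the product measure is the integral over [y] of the length of the section in the
   first coordinate. *)
change (\int[lebesgue_rV R n]_y
  (lebesgue_measure \o ysection (@rV_cons R n @^-1` A)) y = 0)%E.
rewrite (ge0_negligible_integral mN)//; last exact: measurable_fun_ysection.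
apply: integral0_eq => y [_ Ny] /=.
apply: countable_lebesgue_measure0; apply: finite_set_countable.
have q0 : map_poly (meval (y 0)) q != 0.
  by apply/eqP => /polyP/(_ k); rewrite coef_map coef0.
apply: contrapT => /(infinite_set_fset (size (map_poly (meval (y 0)) q)))[B BA].
apply/negP; rewrite -ltnNge; apply: (max_poly_roots q0) (finmap.fset_uniq B).
apply/allP => t /BA; rewrite /ysection /= inE /A /= qE => qt.
by rewrite rootE; apply/eqP.
Qed.

(** * Sublevel sets *)

Section real_curves.
Variable R : realType.
Implicit Types (g dg : R -> R) (I : set R).

Lemma is_derive_continuous g (t dg : R) :
  is_derive t 1 g dg -> {for t, continuous g}.
Proof. by move=> [dgt _]; apply/differentiable_continuous/derivable1_diffP. Qed.

Lemma mean_value_interval g dg I (s t : R) : is_interval I ->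
  (forall u, I u -> is_derive u 1 g (dg u)) -> I s -> I t -> s <= t ->
  exists2 c, I c /\ s <= c <= t & g t - g s = dg c * (t - s).
Proof.
move=> II dgI Is It st.
have Ist u : u \in `[s, t] -> I u.
  by rewrite in_itv /=; exact: II.
have [||c cst gE] := @MVT_segment R g dg s t st.
- by move=> u ust; apply/dgI/Ist; exact: subset_itv_oo_cc ust.
- by apply: derivable_within_continuous => u ust; have [] := dgI _ (Ist _ ust).
by exists c => //; split; [exact: Ist|rewrite in_itv in cst].
Qed.

Lemma derivative_constant_sign g dg I (eta : R) : is_interval I ->
  (forall u, I u -> is_derive u 1 g (dg u)) -> 0 < eta ->
  (forall u, I u -> eta <= `|g u|) ->
  (forall u, I u -> eta <= g u) \/ (forall u, I u -> g u <= - eta).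
Proof.
move=> II dgI eta0 geta.
have [|/existsNP[s /not_implyP[Is /negP gs]]] :=
  pselect (forall u, I u -> eta <= g u); first by left.
right => t It; rewrite -ltNge in gs.
have {}gs : g s <= - eta.
  by have := geta s Is; rewrite ler_normr leNgt gs /= lerNr.
rewrite leNgt; apply/negP => gt.
have {}gt : eta <= g t.
  by have := geta t It; rewrite ler_normr [X in _ || X]lerNr [X in _ || X]leNgt gt orbF.
have ivt a b : a <= b -> I a -> I b -> Num.min (g a) (g b) <= 0 <= Num.max (g a) (g b) -> False.
  move=> ab Ia Ib /(IVT ab) []; last first.
    move=> c; rewrite in_itv /= => cab gc.
    by have := geta c (II _ _ Ia Ib _ cab); rewrite gc normr0 leNgt eta0.
  apply: derivable_within_continuous => u; rewrite in_itv /= => uab.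
  by have [] := dgI _ (II _ _ Ia Ib _ uab).
have gs0 : g s <= 0 by rewrite (le_trans gs)// oppr_le0 ltW.
have gt0 : 0 <= g t by rewrite (le_trans (ltW eta0)).
have [st|ts] := leP s t.
  by apply: (ivt s t) => //; rewrite ge_min gs0 le_max gt0 orbT.
by apply: (ivt t s) => //; [exact: ltW|rewrite ge_min gs0 le_max gt0 orbT].
Qed.

(** The set lies in the interval of radius [r] around any one of its points, whence the factor 2. *)
Lemma lebesgue_diameter_le (J : set R) (r : R) : measurable J -> 0 <= r ->
  (forall s t, J s -> J t -> `|t - s| <= r) ->
  (lebesgue_measure J <= (r *+ 2)%:E)%E.
Proof.
move=> mJ r0 Jr.
have [->|/set0P[s Js]] := eqVneq J set0.
  by rewrite measure0 lee_fin mulrn_wge0.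
apply: (@le_trans _ _ (lebesgue_measure `[s - r, s + r])).
  apply: le_measure; rewrite ?inE//; 
  by move=> t Jt; have := Jr s t Js Jt; rewrite ler_distl /= in_itv.
rewrite lebesgue_measure_itv /= lte_fin; case: ifP => _.
  by rewrite -EFinD lee_fin; lra.
by rewrite lee_fin mulrn_wge0.
Qed.

Lemma measurable_sublevel g dg (A : set R) (eps : R) : measurable A ->
  (forall t, A t -> is_derive t 1 g (dg t)) ->
  measurable (A `&` [set t | `|g t| < eps]).
Proof.
move=> mA dgA; rewrite (_ : _ `&` _ = A `&` g @^-1` `]-eps, eps[); last first.
  by apply/seteqP; split=> t [At]; rewrite /= ltr_norml in_itv.
apply: (_ : measurable_fun A g) => //.
apply: subspace_continuous_measurable_fun => //.
apply: continuous_in_subspaceT => t; rewrite inE => /dgA.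
exact: is_derive_continuous.
Qed.

(* The level sets [h k <= - al], [|h k| < al] and [al <= h k] of the monotone
   function [h k] are intervals, the middle one short. *)
Lemma sublevel_measure (k : nat) (eta kappa : R) : 0 < eta -> 0 < kappa ->
  exists2 eps : R, 0 < eps & forall (h : nat -> R -> R) I, is_interval I ->
    (forall i t, I t -> is_derive t 1 (h i) (h i.+1 t)) ->
    (forall t, I t -> eta <= `|h k t|) ->
    (lebesgue_measure (I `&` [set t | (`|h 0%N t| < eps)%R]) <= kappa%:E)%E.
Proof.
elim: k eta kappa => [|k IHk] eta kappa eta0 kappa0.
  exists eta => // h I _ _ hI; rewrite (_ : _ `&` _ = set0).
    by rewrite measure0 lee_fin ltW.
  by rewrite -subset0 => t [/hI /=]; rewrite leNgt => /negP.
(* With slope at least [eta], the middle set has diameter at most [2 * al / eta = kappa / 4], hence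
   measure at most [kappa / 2]; the two outer sets get [kappa / 4] each from the induction
   hypothesis at level [al]. So [eps] is fixed before [h] and [I]. *)
pose al := eta * kappa / 8.
have al0 : 0 < al by rewrite /al divr_gt0 // mulr_gt0.
have kappa4 : 0 < kappa / 4 by rewrite divr_gt0.
have [eps eps0 IH] := IHk al (kappa / 4) al0 kappa4.
exists eps => // h I II dh hI.
(* The derivative of order [k.+1] has constant sign, and negating every [h i] preserves the
   hypotheses and the sublevel set. *)
wlog hpos : h dh hI / forall t, I t -> eta <= h k.+1 t => [WL|].
  have [|hneg] := derivative_constant_sign II (dh k.+1) eta0 hI; first exact: WL.
  rewrite (_ : [set t | _] = [set t | `|- h 0%N t| < eps]); last first.
    by apply/seteqP; split=> t /=; rewrite normrN.
  apply: (WL (fun i t => - h i t)) => [i t It|t It|t It].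
  - by apply: is_deriveN; exact: dh.
  - by rewrite normrN; exact: hI.
  - by rewrite lerNr; exact: hneg.
have slope s t : I s -> I t -> s <= t -> eta * (t - s) <= h k t - h k s.
  move=> Is It st; have [c [Ic _] ->] := mean_value_interval II (dh k) Is It st.
  by apply: ler_wpM2r; [rewrite subr_ge0|exact: hpos].
have mono s t : I s -> I t -> s <= t -> h k s <= h k t.
  move=> Is It st; rewrite -subr_ge0 (le_trans _ (slope s t Is It st))//.
  by rewrite mulr_ge0 ?subr_ge0// ltW.
pose L := I `&` [set t | h k t <= - al].
pose U := I `&` [set t | al <= h k t].
pose J := I `&` [set t | `|h k t| < al].
have IL : is_interval L.
  move=> s t [Is _] [It ht] u /andP[su ut].
  have Iu : I u by apply: II Is It _ _; rewrite su ut.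
  by split=> //=; exact: le_trans (mono _ _ Iu It ut) ht.
have IU : is_interval U.
  move=> s t [Is hs] [It _] u /andP[su ut].
  have Iu : I u by apply: II Is It _ _; rewrite su ut.
  by split=> //=; exact: le_trans hs (mono _ _ Is Iu su).
have IJ : is_interval J.
  move=> s t [Is /=]; rewrite ltr_norml => /andP[hs _] [It /=].
  rewrite ltr_norml => /andP[_ ht] u /andP[su ut].
  have Iu : I u by apply: II Is It _ _; rewrite su ut.
  split=> //=; rewrite ltr_norml (lt_le_trans hs (mono _ _ Is Iu su)) /=.
  exact: le_lt_trans (mono _ _ Iu It ut) ht.
have mI := is_interval_measurable II.
have mL := is_interval_measurable IL.
have mU := is_interval_measurable IU.
have mJ := is_interval_measurable IJ.
set S := [set t | _].
have mS A : A `<=` I -> measurable A -> measurable (A `&` S).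
  by move=> AI mA; apply: (@measurable_sublevel (h 0%N) (h 1%N) _ _ mA) => t /AI; exact: dh.
have LUI : L `<=` I /\ U `<=` I by split=> t [].
have LS : (lebesgue_measure (L `&` S) <= (kappa / 4)%:E)%E.
  apply: IH => // [i t [It _]|t [_ /= ht]]; first exact: dh.
  by rewrite ler_normr [X in _ || X]lerNr ht orbT.
have US : (lebesgue_measure (U `&` S) <= (kappa / 4)%:E)%E.
  apply: IH => // [i t [It _]|t [_ /= ht]]; first exact: dh.
  by rewrite ler_normr ht.
have JS : (lebesgue_measure J <= (kappa / 2)%:E)%E.
  have -> : kappa / 2 = (kappa / 4) *+ 2 by lra.
  apply: lebesgue_diameter_le => [//||s t]; first by rewrite divr_ge0// ltW.
  wlog st : s t / s <= t => [WL Js Jt|].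
    by have [/WL|/ltW/WL] := leP s t; [exact|rewrite distrC; exact].
  move=> [Is /=]; rewrite ltr_norml => /andP[hs _].
  move=> [It /=]; rewrite ltr_norml => /andP[_ ht].
  rewrite ger0_norm ?subr_ge0// -(ler_pM2l eta0).
  rewrite (le_trans (slope s t Is It st))//.
  have -> : eta * (kappa / 4) = al + al by rewrite /al; lra.
  by rewrite lerD ?(ltW ht)// lerNl ltW.
have cover : I `&` S `<=` (L `&` S) `|` J `|` (U `&` S).
  move=> t [It St]; have [hL|hL] := leP (h k t) (- al); first by left; left.
  have [hU|hU] := leP al (h k t); first by right.
  by left; right; split=> //=; rewrite ltr_norml hL.
have [LI UI] := LUI; have mLS := mS _ LI mL; have mUS := mS _ UI mU.
have mIS := mS _ (@subset_refl _ I) mI.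
apply: (@le_trans _ _ (lebesgue_measure (L `&` S `|` J `|` U `&` S))).
  apply: le_measure => //; rewrite ?inE//.
  by apply: measurableU => //; exact: measurableU.
apply: (@le_trans _ _
  (lebesgue_measure (L `&` S `|` J) + lebesgue_measure (U `&` S))%E).
  by apply: measureU2 => //; exact: measurableU.
have -> : kappa = kappa / 4 + kappa / 2 + kappa / 4 by lra.
rewrite !EFinD leeD//; apply: (@le_trans _ _
  (lebesgue_measure (L `&` S) + lebesgue_measure J)%E); first exact: measureU2.
exact: leeD.
Qed.

End real_curves.

(** * Gronwall's inequality and uniqueness *)

(** A bound on the absolute value of the derivative controls growth in both time directions. *)
Lemma gronwall (R : realType) (E dE : R -> R) (I : set R) (C : R) :
  is_interval I -> (forall t, I t -> is_derive t 1 E (dE t)) ->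
  (forall t, I t -> `|dE t| <= C * E t) ->
  forall s t, I s -> I t -> E t <= E s * expR (C * `|t - s|).
Proof.
move=> II dEI dEC.
(* The product of [E] with [expR (c * t)] is nonincreasing for [c = - C], which settles [s <= t],
   and nondecreasing for [c = C], which settles [t <= s]. *)
have dphi c t : I t ->
    is_derive t 1 (E * (fun u => expR (c * u))) ((dE t + c * E t) * expR (c * t)).
  move=> It; have d1 := dEI t It.
  have d2 : is_derive t 1 (fun u : R => c * u) c.
    by apply: is_derive_eq; rewrite /GRing.scale /= mulr1.
  have d3 := is_derive1_comp (is_derive_expR (c * t)) d2.
  by apply: is_derive_eq (is_deriveM d1 d3) _; rewrite /GRing.scale /=; ring.
move=> s t Is It; have [st|/ltW ts] := leP s t.
  have [c [Ic _]] := mean_value_interval II (dphi (- C)) Is It st.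
  rewrite ger0_norm ?subr_ge0//= => phiE.
  have phi_le : E t * expR (- C * t) <= E s * expR (- C * s).
    rewrite -subr_le0 phiE mulr_le0_ge0 ?subr_ge0// mulr_le0_ge0 ?expR_ge0//.
    by have := dEC c Ic; rewrite ler_norml => /andP[]; lra.
  move: phi_le; rewrite -(ler_pM2r (expR_gt0 (C * t))) -!mulrA -!expRD.
  by rewrite mulNr addNr expR0 mulr1 mulrBr addrC mulNr.
have [c [Ic _]] := mean_value_interval II (dphi C) It Is ts.
rewrite distrC ger0_norm ?subr_ge0//= => phiE.
have phi_le : E t * expR (C * t) <= E s * expR (C * s).
  rewrite -subr_ge0 phiE mulr_ge0 ?subr_ge0// mulr_ge0 ?expR_ge0//.
  by have := dEC c Ic; rewrite ler_norml => /andP[]; lra.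
move: phi_le; rewrite -(ler_pM2r (expR_gt0 (- (C * t)))) -!mulrA -!expRD.
by rewrite subrr expR0 mulr1 mulrBr.
Qed.

Lemma bounded_on_segment (R : realType) (m : nat) (u du : 'I_m -> R -> R) (a b : R) :
  a <= b -> (forall i t, t \in `[a, b] -> is_derive t 1 (u i) (du i t)) ->
  exists r, forall i t, t \in `[a, b] -> `|u i t| <= r.
Proof.
move=> ab dui.
have cu i : {within `[a, b], continuous (u i)}.
  by apply: derivable_within_continuous => t tab; have [] := dui i t tab.
have H i : exists r, forall t, t \in `[a, b] -> `|u i t| <= r.
  have [c _ cM] := EVT_max ab (cu i); have [d _ dM] := EVT_min ab (cu i).
  exists (`|u i c| + `|u i d|) => t tab; have := cM t tab; have := dM t tab.
  have := ler_norm (u i c); have := ler_norm (- u i d); rewrite normrN.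
  have := normr_ge0 (u i c); have := normr_ge0 (u i d).
  by rewrite ler_norml => *; apply/andP; split; lra.
have [r rP] := choice H; exists (\sum_i `|r i|) => i t tab.
rewrite (le_trans (rP i t tab))// (le_trans (ler_norm _))// (bigD1 i)//=.
by rewrite lerDl sumr_ge0.
Qed.

Definition solves (R : realType) (n : nat) (F : 'I_n -> mpoly n R)
    (u : R -> 'rV[R]_n) (I : set R) : Prop :=
  forall t, I t -> forall i,
    is_derive t 1 (fun s => u s 0 i) (meval (u t 0) (F i)).

(** Squared, so that it is differentiable along a pair of solutions. *)
Definition sqdist (R : realType) (n : nat) (x y : 'rV[R]_n) : R :=
  \sum_i (x 0 i - y 0 i) ^+ 2.

Lemma sqdist_coord (R : realType) (n : nat) (x y : 'rV[R]_n) i :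
  (x 0 i - y 0 i) ^+ 2 <= sqdist x y.
Proof. by rewrite /sqdist (bigD1 i)//= lerDl sumr_ge0// => *; rewrite sqr_ge0. Qed.

Lemma sqdist_eq0 (R : realType) (n : nat) (x y : 'rV[R]_n) :
  sqdist x y <= 0 -> x = y.
Proof.
move=> xy0; apply/rowP => i; apply/eqP.
by rewrite -subr_eq0 -sqrf_eq0 eq_le sqr_ge0 (le_trans (sqdist_coord _ _ _)).
Qed.

Section flow_theory.
Variables (R : realType) (n : nat) (F : 'I_n -> mpoly n R).
Implicit Types (u v : R -> 'rV[R]_n) (x y : 'rV[R]_n) (I : set R).

(** The field is Lipschitz on the box, so the derivative of the squared distance is at most a
    multiple of the squared distance, and Gronwall applies. The constant depends on [r] only. *)
Lemma sqdist_solves (r : R) : exists C, forall u v I, is_interval I ->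
  solves F u I -> solves F v I ->
  (forall t, I t -> in_box r (u t)) -> (forall t, I t -> in_box r (v t)) ->
  forall s t, I s -> I t ->
    sqdist (u t) (v t) <= sqdist (u s) (v s) * expR (C * `|t - s|).
Proof.
have [C C0 CF] := meval_lipschitz_fin F r.
exists (C * (n * n)%:R *+ 4) => u v I II uI vI ur vr.
pose d t i := u t 0 i - v t 0 i.
pose fd t i := meval (u t 0) (F i) - meval (v t 0) (F i).
apply: (@gronwall _ _ (fun t => \sum_i (d t i * fd t i) *+ 2)) => // t It.
  rewrite (_ : (fun t => _) = \sum_i (fun s => (u s 0 i - v s 0 i) ^+ 2)).
    apply: is_derive_sum => i.
    have dd : is_derive t 1 (fun s => d s i) (fd t i) :=
      is_deriveB (uI t It i) (vI t It i).
    by apply: is_derive_eq (is_deriveX 2 dd) _; rewrite /GRing.scale /=; ring.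
  by apply/funext => s; rewrite fct_sumE.
set D := sqdist (u t) (v t).
have dD i j : `|d t i| * `|d t j| <= D *+ 2.
  have := sqdist_coord (u t) (v t) i; have := sqdist_coord (u t) (v t) j.
  rewrite -/D -/(d t i) -/(d t j) -(real_normK (num_real (d t i))).
  rewrite -(real_normK (num_real (d t j))).
  have := sqr_ge0 (`|d t i| - `|d t j|); rewrite sqrrB; set a := `|d t i|; set b := `|d t j|.
  by have := sqr_ge0 a; lra.
(* One factor 2 comes from differentiating a square, the other from [dD]; the double sum contributes
   [n * n]. *)
apply: (@le_trans _ _ (\sum_(i < n) \sum_(j < n) C * D *+ 4)); last first.
  rewrite le_eqVlt; apply/orP; left; apply/eqP.
  by rewrite !sumr_const !card_ord; ring.
rewrite (le_trans (ler_norm_sum _ _ _))// ler_sum// => i _.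
rewrite normrMn normrM.
apply: (@le_trans _ _ ((`|d t i| * (C * \sum_j `|d t j|)) *+ 2)).
  by rewrite ler_wMn2r// ler_wpM2l//; have [] := CF i _ _ (ur t It) (vr t It).
rewrite mulrCA [in leLHS]mulr_sumr [in leLHS]mulr_sumr -sumrMnl ler_sum// => j _.
by have := ler_wpM2l C0 (dD i j); lra.
Qed.

(** The segment between [0] and [t] lies in both intervals. Both solutions are bounded there, hence
    in a common box, and Gronwall starts from distance zero. *)
Lemma solves_unique u v I J (t : R) : is_interval I -> is_interval J ->
  solves F u I -> solves F v J -> I 0 -> J 0 -> I t -> J t ->
  u 0 = v 0 -> u t = v t.
Proof.
move=> II IJ uI vJ I0 J0 It Jt uv0.
pose a := Num.min 0 t; pose b := Num.max 0 t.
have ab : a <= b by rewrite /a /b ge_min !le_max !lexx.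
have sub A s : is_interval A -> A 0 -> A t -> s \in `[a, b] -> A s.
  move=> IA A0 At; rewrite in_itv /= /a /b ge_min le_max.
  by case: (leP 0 t) => t0 /andP[as_ sb]; [apply: (IA 0 t)|apply: (IA t 0)] => //;
    apply/andP; split; lra.
have [r1 r1P] := @bounded_on_segment R n (fun i s => u s 0 i)
  (fun i s => meval (u s 0) (F i)) a b ab
  (fun i s sab => uI s (sub I s II I0 It sab) i).
have [r2 r2P] := @bounded_on_segment R n (fun i s => v s 0 i)
  (fun i s => meval (v s 0) (F i)) a b ab
  (fun i s sab => vJ s (sub J s IJ J0 Jt sab) i).
have [C CP] := sqdist_solves (Num.max r1 r2).
have a0 : 0 \in `[a, b] by rewrite in_itv /= /a /b ge_min le_max lexx.
have at_ : t \in `[a, b] by rewrite in_itv /= /a /b ge_min le_max lexx !orbT.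
apply: sqdist_eq0.
have := CP u v [set` `[a, b]] (@interval_is_interval _ `[a, b])
  (fun s sab => uI s (sub I s II I0 It sab))
  (fun s sab => vJ s (sub J s IJ J0 Jt sab)) _ _ 0 t a0 at_.
rewrite uv0 [X in _ <= X * _](_ : _ = 0); last first.
  by rewrite /sqdist big1// => i _; rewrite subrr expr0n.
by rewrite mul0r; apply=> s sab i; rewrite le_max ?r1P ?r2P ?orbT.
Qed.

End flow_theory.

(** * The flow on a compact invariant set *)

(** Continuity relative to [K] suffices: the preimage of an open set is the trace on [K] of a union
    of interiors of balls. *)
Lemma measurable_fun_locally (R : realType) (n : nat) (K : set 'rV[R]_n)
    (g : 'rV[R]_n -> 'rV[R]_n) : measurable K ->
  (forall x e, K x -> 0 < e ->
    exists2 d, 0 < d & forall y, K y -> ball x d y -> ball (g x) e (g y)) ->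
  measurable_fun K g.
Proof.
move=> mK gc; apply: (measurability (@open 'rV[R]_n)) => // _ [U oU <-].
pose G := [set p : 'rV[R]_n * R | 0 < p.2 /\
  forall y, K y -> ball p.1 p.2 y -> U (g y)].
have -> : K `&` g @^-1` U = K `&` \bigcup_(p in G) (ball p.1 p.2)°.
  apply/seteqP; split => x [Kx /=] => [Ugx|[p [p0 Up] xp]]; last first.
    by split=> //; apply: Up => //; exact: interior_subset xp.
  split=> //; have /nbhs_ballP[e /= e0 eU] := open_nbhs_nbhs (conj oU Ugx).
  have [d d0 dg] := gc x e Kx e0.
  exists (x, d); last exact: nbhsx_ballx.
  by split=> //= y Ky xy; apply: eU; exact: dg.
apply: measurableI => //; apply: sub_sigma_algebra.
by apply: bigcup_open => p _; exact: open_interior.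
Qed.

Lemma is_derive_coord (R : realType) (n : nat) (g : R -> 'rV[R]_n) (t : R) v i :
  is_derive t 1 g v -> is_derive t 1 (fun s => g s 0 i) (v 0 i).
Proof.
move=> [dg <-]; rewrite (derive_mx dg) mxE; apply: DeriveDef => //.
exact: (derivable_mxP _ _ _).1.
Qed.

Section flow_on_compact.
Variables (R : realType) (n : nat) (F : 'I_n -> mpoly n R) (K : set 'rV[R]_n).
Hypothesis A1 : compact_invariant (vector_field F) K.
Let Phi := flow (vector_field F).

Lemma solves_vector_field (g : R -> 'rV[R]_n) (I : set R) :
  (forall s, I s -> is_derive s 1 g (vector_field F (g s))) -> solves F g I.
Proof.
by move=> dg s Is i; have := is_derive_coord i (dg s Is); rewrite mxE.
Qed.

(** The value chosen by [xget] comes from some solution, and uniqueness identifies it with any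
    other. *)
Lemma flow_value_unique t x y :
  is_flow_value (vector_field F) t x y -> Phi t x = y.
Proof.
move=> xy; rewrite /Phi /flow; case: xgetP => [z _|/(_ y)//].
case: xy => [a [b [g [ab0 abt dg g0 gt]]]].
move=> [c [d [h [cd0 cdt dh h0 ht]]]].
rewrite -gt -ht; apply: (@solves_unique _ _ F h g [set` `]c, d[] [set` `]a, b[]) => //.
- exact: interval_is_interval.
- exact: interval_is_interval.
- exact: solves_vector_field.
- exact: solves_vector_field.
- by rewrite g0 h0.
Qed.

Lemma flow_in t x : K x -> K (Phi t x).
Proof. by case: A1 => _ _ + Kx; apply; exists x. Qed.

Lemma flow0 x : K x -> Phi 0 x = x.
Proof.
case: A1 => _ /(_ x 0) + _ Kx => /(_ Kx)[y [a [b [g [ab0 _ dg g0 _]]]]].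
by apply: flow_value_unique; exists a, b, g; split.
Qed.

(** [flow] chooses a value at each time separately. On the open interval of the solution [g] that
    witnesses time [t], uniqueness makes the whole orbit equal to [g], so the derivative carries
    over. *)
Lemma is_derive_flow x (t : R) i : K x ->
  is_derive t 1 (fun s => Phi s x 0 i) (meval (Phi t x 0) (F i)).
Proof.
case: A1 => _ + _ Kx => /(_ x t Kx)[y [a [b [g [ab0 abt dg g0 _]]]]].
have Phig s : s \in `]a, b[ -> Phi s x = g s.
  by move=> sab; apply: flow_value_unique; exists a, b, g; split.
have dgi := @solves_vector_field g [set` `]a, b[] dg t abt i.
rewrite Phig//; apply: near_eq_is_derive dgi.
have tnear := near_in_itvoo abt.
by near=> s; rewrite Phig//; near: s; exact: tnear.
Unshelve. all: by end_near. Qed.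

Lemma flow_solves x : K x -> solves F (fun t => Phi t x) setT.
Proof. by move=> Kx t _ i; exact: is_derive_flow. Qed.

(** As functions of [t], both sides are solutions starting at [Phi s x]. *)
Lemma flow_add s t x : K x -> Phi (s + t) x = Phi t (Phi s x).
Proof.
move=> Kx; have Ksx := flow_in s Kx.
apply: (@solves_unique _ _ F (fun t => Phi (s + t) x)
  (fun t => Phi t (Phi s x)) setT setT) => //.
- move=> r _ i.
  have ds : is_derive r 1 (fun u : R => s + u) 1.
    by apply: is_derive_eq (is_deriveD (is_derive_cst s r 1) (is_derive_id r 1)) _; rewrite add0r.
  have := is_derive1_comp (is_derive_flow (s + r) i Kx) ds.
  by rewrite /GRing.scale /= mulr1.
- exact: flow_solves.
- by rewrite addr0 flow0.
Qed.

Lemma compact_in_box : exists r, forall x, K x -> in_box r x.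
Proof.
have [cK _ _] := A1; have [M [_ Kb]] := compact_bounded cK.
exists (M + 1) => x Kx i; have := Kb (M + 1) _ x Kx.
rewrite ltrDl ltr01 => /(_ isT); apply: le_trans.
by rewrite [leRHS]/Num.Def.normr/= mx_normrE; exact: (le_bigmax _ _ (0, i)).
Qed.

Lemma invariant_compact_measurable : measurable K.
Proof.
rewrite -[K]setCK; apply: measurableC; apply: sub_sigma_algebra.
have [cK _ _] := A1.
by apply: closed_openC; apply: compact_closed => //; exact: norm_hausdorff.
Qed.

Lemma measurable_flow t : measurable_fun K (Phi t).
Proof.
apply: measurable_fun_locally => [|x e Kx e0]; first exact: invariant_compact_measurable.
have [r Kr] := compact_in_box.
have [C CP] := sqdist_solves F r.
pose M := expR (C * `|t - 0|).
have M0 : 0 < M by exact: expR_gt0.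
(* The bound 1 lets a squared coordinate difference be replaced by the difference itself; [n.+1] in
   place of [n] gives a strict inequality and avoids division by zero. *)
exists (Num.min 1 (e ^+ 2 / (n.+1%:R * M))).
  by rewrite lt_min ltr01 divr_gt0 ?exprn_gt0// mulr_gt0.
move=> y Ky [d0 xy]; split=> // i j; rewrite ord1 {i}.
have le := CP _ _ setT _ (flow_solves Kx) (flow_solves Ky) _ _ 0 t Logic.I Logic.I.
rewrite /ball /= -(ltr_pXn2r (_ : 0 < 2)%N) ?nnegrE ?normr_ge0 ?(ltW e0)//.
rewrite real_normK ?num_real//; apply: le_lt_trans (sqdist_coord _ _ _) _.
rewrite (le_lt_trans (le _ _ _))//; [by move=> s _; exact/Kr/flow_in|
  by move=> s _; exact/Kr/flow_in|rewrite -/M !flow0//].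
rewrite -ltr_pdivlMr//; set dl := e ^+ 2 / (n.+1%:R * M) in xy d0.
have dl0 : 0 < dl by rewrite divr_gt0 ?exprn_gt0// mulr_gt0.
have -> : e ^+ 2 / M = n.+1%:R * dl.
  by rewrite /dl invfM mulrCA mulVKf ?pnatr_eq0.
apply: (@le_lt_trans _ _ (\sum_(k < n) dl)).
  apply: ler_sum => k _; have := xy 0 k; rewrite /ball /= lt_min => /andP[xy1 xye].
  rewrite -real_normK ?num_real// expr2 (le_trans _ (ltW xye))//.
  by rewrite ler_piMr// ltW.
by rewrite sumr_const card_ord -[X in X < _]mulr_natl ltr_pM2r// ltr_nat.
Qed.

End flow_on_compact.

(** * The maximal ergodic inequality *)

Definition visit_count (T : Type) (f : T -> T) (B : set T) (N : nat) (x : T) : nat :=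
  \sum_(j < N) (`[< B (iter j f x) >] : nat).

Section maximal_inequality.
Context d (T : measurableType d) (R : realType) (mu : probability T R).
Variables (f : T -> T) (mf : measurable_fun [set: T] f).
Hypothesis f_mu : forall A, measurable A -> mu (f @^-1` A) = mu A.
Variables (B : set T) (mB : measurable B) (l : R) (l0 : 0 <= l).

(* The largest of the partial sums of [l * \1_B - 1] along the orbit, the empty
   sum included, as in Garsia's proof of the maximal ergodic theorem. *)
Fixpoint max_sum (N : nat) (x : T) : R :=
  if N is N'.+1 then Num.max 0 (l * \1_B x + max_sum N' (f x) - 1) else 0.

Lemma max_sum_ge0 N x : 0 <= max_sum N x.
Proof. by case: N => [|N] //=; rewrite le_max lexx. Qed.

Lemma max_sum_nondecreasing N x : max_sum N x <= max_sum N.+1 x.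
Proof.
elim: N x => [|N IHN] x; first exact: max_sum_ge0.
rewrite [leRHS]/= [leLHS]/= ge_max !le_max lexx /=; apply/orP; right.
by rewrite lerD2r lerD2l; exact: IHN.
Qed.

Lemma max_sum_le N x : max_sum N x <= N%:R * l.
Proof.
elim: N x => [|N IHN] x; first by rewrite mul0r.
rewrite [leLHS]/= ge_max mulr_ge0//= -natr1 mulrDl mul1r.
rewrite lerBlDr addrC -addrA lerD// ler_wpDr// indicE.
by case: (_ \in _); rewrite ?mulr1 ?mulr0.
Qed.

Lemma measurable_max_sum N : measurable_fun [set: T] (max_sum N).
Proof.
elim: N => [|N IHN]; first exact: measurable_cst.
apply: measurable_maxr; first exact: measurable_cst.
apply: measurable_funB; last exact: measurable_cst.
apply: measurable_funD; last exact: measurableT_comp.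
by apply: measurable_funM; [exact: measurable_cst|exact: measurable_indic].
Qed.

(** The sum over all [N] terms is among those that [max_sum] maximises. *)
Lemma max_sum_visit N x : l * (visit_count f B N x)%:R <= max_sum N x + N%:R.
Proof.
elim: N x => [|N IHN] x; first by rewrite /visit_count big_ord0 mulr0 add0r.
rewrite /visit_count big_ord_recl natrD mulrDr /=.
have -> : (`[< B x >] : nat)%:R = \1_B x :> R.
  by rewrite indicE; congr (_%:R); congr nat_of_bool; apply/asboolP/idP; rewrite inE.
under eq_bigr do rewrite add0n -iterS iterSr.
have := IHN (f x); rewrite /visit_count => IHx.
have : l * \1_B x + max_sum N (f x) - 1 <= max_sum N.+1 x.
  by rewrite /= le_max lexx orbT.
rewrite -[Num.max _ _]/(max_sum N.+1 x) -natr1 addrA => MS; lra.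
Qed.

(** Where the maximum is positive it is reached by a nonempty sum; removing its first term leaves a
    sum along the orbit of [f x]. Elsewhere the left side is at most 0. *)
Lemma max_sum_step N x :
  max_sum N x + \1_[set y | 0 < max_sum N y] x <= l * \1_B x + max_sum N (f x).
Proof.
have [M0|M0] := ltP 0 (max_sum N x); last first.
  rewrite indicE memNset ?addr0; last by apply/negP; rewrite -leNgt.
  by rewrite (le_trans M0)// addr_ge0 ?max_sum_ge0// mulr_ge0// indicE ler0n.
rewrite [X in _ + X]indicE mem_set//.
case: N M0 => [|N]; first by rewrite ltxx.
rewrite /= lt_max ltxx /= => M0; rewrite max_r ?(ltW M0)// subrK lerD2l.
exact: max_sum_nondecreasing.
Qed.

(** Integrating [max_sum_step], the integrals of [max_sum N] and of its composition with [f] agree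
    by invariance and cancel. *)
Lemma maximal_inequality_bounded N :
  (mu [set x | 0%R < max_sum N x]%R <= l%:E * mu B)%E.
Proof.
set E := [set x | _].
have mE : measurable E.
  rewrite (_ : E = max_sum N @^-1` `]0, +oo[); last first.
    by apply/seteqP; split => x /=; rewrite in_itv/= andbT.
  by rewrite -[X in measurable X]setTI; exact: measurable_max_sum.
have mM := measurable_max_sum N.
have ME := (measurable_EFinP _ _).2 mM.
pose I := (\int[mu]_x (max_sum N x)%:E)%E.
have I0 : (0 <= I)%E by apply: integral_ge0 => x _; rewrite lee_fin max_sum_ge0.
(* Cancelling [I] in the extended reals requires it to be finite. *)
have Ifin : I \is a fin_num.
  rewrite ge0_fin_numE//; apply: (@le_lt_trans _ _ (\int[mu]_x (N%:R * l)%:E)%E).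
    apply: ge0_le_integral => //= x _; first by rewrite lee_fin max_sum_ge0.
    by rewrite lee_fin max_sum_le.
  by rewrite integral_cst//= [mu _]probability_setT mule1 ltry.
have Ef : (\int[mu]_x (max_sum N (f x))%:E = I)%E.
  transitivity (\int[pushforward mu f]_x (max_sum N x)%:E)%E.
    rewrite (ge0_integral_pushforward mf)//= => x _.
    by rewrite lee_fin max_sum_ge0.
  by apply: eq_measure_integral => A mA _; exact: f_mu.
have : (\int[mu]_x ((max_sum N x)%:E + (\1_E x)%:E) <=
        \int[mu]_x ((l * \1_B x)%:E + (max_sum N (f x))%:E))%E.
  apply: ge0_le_integral => //=.
  - by move=> x _; rewrite adde_ge0// lee_fin ?max_sum_ge0// indicE ler0n.
  - apply: emeasurable_funD => //; apply/measurable_EFinP; exact: measurable_indic.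
  - apply: emeasurable_funD; apply/measurable_EFinP; last exact: measurableT_comp.
    by apply: measurable_funM; [exact: measurable_cst|exact: measurable_indic].
  - by move=> x _; rewrite -!EFinD lee_fin max_sum_step.
rewrite ge0_integralD//=; last 2 first.
- by move=> x _; rewrite lee_fin max_sum_ge0.
- by apply/measurable_EFinP; exact: measurable_indic.
rewrite ge0_integralD//=; last 4 first.
- by move=> x _; rewrite lee_fin mulr_ge0// indicE ler0n.
- apply/measurable_EFinP.
  by apply: measurable_funM; [exact: measurable_cst|exact: measurable_indic].
- by move=> x _; rewrite lee_fin max_sum_ge0.
- by apply/measurable_EFinP; exact: measurableT_comp.
rewrite Ef -/I integral_indic// setIT addeC leeD2rE//.
under eq_integral do rewrite EFinM.
rewrite ge0_integralZl_EFin//=; last first.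
  by apply/measurable_EFinP; exact: measurable_indic.
by rewrite integral_indic// setIT.
Qed.

(** The exceptional set is the increasing union of the sets where [max_sum N] is positive;
    continuity from below carries over the bound, which is uniform in [N]. *)
Lemma visit_maximal_inequality :
  exists E, [/\ measurable E, (mu E <= l%:E * mu B)%E &
    forall x, ~ E x -> forall N, l * (visit_count f B N x)%:R <= N%:R].
Proof.
pose E N := [set x | 0 < max_sum N x].
have mE N : measurable (E N).
  rewrite (_ : E N = max_sum N @^-1` `]0, +oo[); last first.
    by apply/seteqP; split => x /=; rewrite in_itv/= andbT.
  by rewrite -[X in measurable X]setTI; exact: measurable_max_sum.
have mU : measurable (\bigcup_N E N) by exact: bigcup_measurable.
exists (\bigcup_N E N); split=> // [|x Ex N]; last first.
  rewrite (le_trans (max_sum_visit N x))// gerDr leNgt.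
  by apply/negP => M0; apply: Ex; exists N.
have ndE : nondecreasing_seq E.
  apply/nondecreasing_seqP => N; apply/subsetPset => x; rewrite /E /= => M0.
  exact: lt_le_trans M0 (max_sum_nondecreasing N x).
have cE : mu \o E @ \oo --> mu (\bigcup_N E N) := nondecreasing_cvg_mu mE mU ndE.
rewrite -(cvg_lim _ cE)//; apply: lime_le; first by apply/cvg_ex; eexists; exact: cE.
by apply: nearW => N; exact: maximal_inequality_bounded.
Qed.

End maximal_inequality.

(** * Nondegeneracy *)

Section lie_iterates.
Variables (R : realType) (n : nat) (F : 'I_n -> mpoly n R).
Implicit Types (p q : mpoly n R).

Lemma lie_poly_sum (c : 'I_n -> R) (P : 'I_n -> mpoly n R) :
  lie_poly F (\sum_i mpolyC n (c i) * P i) =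
  \sum_i mpolyC n (c i) * lie_poly F (P i).
Proof.
have L0 : lie_poly F 0 = 0 by rewrite -(mpolyC0 n R) lie_polyC.
rewrite (big_morph (lie_poly F) (lie_polyD F) L0); apply: eq_bigr => i _.
rewrite /lie_poly mulr_sumr; apply: eq_bigr => k _.
by rewrite mderivM mderivC mul0r add0r mulrA.
Qed.

Lemma iter_lie_derivative k i :
  iter k (lie_derivative F) F i = iter k (lie_poly F) (F i).
Proof. by elim: k => [//|k IHk] /=; rewrite /lie_derivative IHk. Qed.

Definition affine_poly (a : 'rV[R]_n) (b : R) : mpoly n R :=
  \sum_i mpolyC n (a 0 i) * mpolyX R (mnm1 i) - mpolyC n b.

Lemma meval_affine_poly a b (y : 'rV[R]_n) :
  meval (y 0) (affine_poly a b) = \sum_i a 0 i * y 0 i - b.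
Proof.
rewrite /affine_poly mevalB mevalC; congr (_ - _).
by rewrite rmorph_sum; apply: eq_bigr => i _; rewrite /= mevalM mevalC mevalXU.
Qed.

(** The first Lie derivative turns an affine function into [a] applied to the field, so order [k.+1]
    meets column [k] of [lie_matrix]. *)
Lemma iter_lie_affine_poly a b k :
  iter k.+1 (lie_poly F) (affine_poly a b) =
  \sum_i mpolyC n (a 0 i) * iter k (lie_derivative F) F i.
Proof.
elim: k => [|k IHk].
  rewrite /affine_poly /= -mpolyCN lie_polyD lie_polyC addr0 lie_poly_sum.
  by apply: eq_bigr => i _; rewrite lie_polyX.
rewrite iterS IHk lie_poly_sum; apply: eq_bigr => i _.
by rewrite !iter_lie_derivative.
Qed.

(** Multiplying the row of derivatives [a *m M] by the adjugate of [M] gives [a] times the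
    determinant. At a nonzero coordinate of [a], the derivatives cannot all be small, since the
    cofactors are bounded on [K]. *)
Lemma lie_det_nondegenerate (K : set 'rV[R]_n) (r dl : R) (a : 'rV[R]_n) (b : R) :
  (forall x, K x -> in_box r x) -> 0 < dl -> a != 0 ->
  exists2 eta, 0 < eta & forall y, K y -> dl <= `|meval (y 0) (lie_det F)| ->
    exists k : 'I_n, eta <= `|meval (y 0) (iter k.+1 (lie_poly F) (affine_poly a b))|.
Proof.
move=> Kr dl0 /eqP a0.
have [i ai] : exists i, a 0 i != 0.
  apply: contrapT => /forallNP a_0; apply: a0; apply/rowP => i; rewrite mxE.
  by have /negP := a_0 i; rewrite negbK => /eqP.
have [A A0 AP] := meval_lipschitz_fin (fun k => (\adj (lie_matrix F)) k i) r.
have nA0 : 0 < n%:R * A + 1 by rewrite ltr_wpDl// mulr_ge0.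
(* Chosen so that [n * A * eta] is strictly below [dl * |a 0 i|]; the [+ 1] also covers [A = 0]. *)
exists (dl * `|a 0 i| / (n%:R * A + 1)).
  by rewrite divr_gt0// mulr_gt0// normr_gt0.
move=> y Ky Qy; apply: contrapT => /forallNP Hk.
set eta := _ / _ in Hk.
pose M := map_mx (meval (y 0)) (lie_matrix F).
have HE (k : 'I_n) : meval (y 0) (iter k.+1 (lie_poly F) (affine_poly a b)) = (a *m M) 0 k.
  rewrite iter_lie_affine_poly rmorph_sum mxE; apply: eq_bigr => j _.
  by rewrite /= mevalM mevalC !mxE.
have detE : a 0 i * meval (y 0) (lie_det F) =
    \sum_k (a *m M) 0 k * meval (y 0) (\adj (lie_matrix F) k i).
  transitivity ((a *m M *m \adj M) 0 i).
    by rewrite -mulmxA mul_mx_adj mul_mx_scalar mxE det_map_mx mulrC.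
  by rewrite mxE; apply: eq_bigr => k _; rewrite -map_mx_adj !mxE.
suff : `|a 0 i| * dl < `|a 0 i| * dl by rewrite ltxx.
apply: (@le_lt_trans _ _ (n%:R * A * eta)).
  rewrite (le_trans (ler_wpM2l _ Qy))// -normrM detE (le_trans (ler_norm_sum _ _ _))//.
  apply: (@le_trans _ _ (\sum_(k < n) eta * A)); last first.
    by rewrite sumr_const card_ord -[leLHS]mulr_natl mulrCA mulrC mulrA [X in X * _]mulrC.
  apply: ler_sum => k _; rewrite normrM ler_pM//; last first.
    by have [] := AP k _ _ (Kr y Ky) (Kr y Ky).
  by rewrite -HE; have /negP := Hk k; rewrite -ltNge => /ltW.
rewrite /eta mulrA ltr_pdivrMr//.
have : 0 < dl * `|a 0 i| by rewrite mulr_gt0// normr_gt0.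
set w := `|a 0 i|; set z := n%:R * A; lra.
Qed.

End lie_iterates.

Lemma hyperplane_neighborhood (R : realType) (n : nat) (a : 'rV[R]_n) (b e : R)
    (y : 'rV[R]_n) : a != 0 ->
  euclidean_dist y [set z : 'rV[R]_n | \sum_(i < n) a 0 i * z 0 i = b] < e ->
  `|\sum_i a 0 i * y 0 i - b| < (\sum_i `|a 0 i|) * e.
Proof.
move=> /eqP a0 dyH.
have [i ai] : exists i, a 0 i != 0.
  apply: contrapT => /forallNP a_0; apply: a0; apply/rowP => i; rewrite mxE.
  by have /negP := a_0 i; rewrite negbK => /eqP.
have A0 : 0 < \sum_i `|a 0 i|.
  by rewrite (bigD1 i)//= ltr_wpDr ?sumr_ge0// normr_gt0.
set H := [set z | _] in dyH.
(* The multiple [b / a_i] of the [i]-th basis vector lies on the hyperplane, so the infimum is over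
   a nonempty set. *)
have H0 : [set euclidean_norm (y - z) | z in H] !=set0.
  exists (euclidean_norm (y - (b / a 0 i) *: delta_mx 0 i)).
  exists ((b / a 0 i) *: delta_mx 0 i) => //; rewrite /H /= (bigD1 i)//= big1.
    by rewrite !mxE !eqxx mulr1 addr0 mulrC divfK.
  by move=> j ji; rewrite !mxE (negPf ji) andbF mulr0 mulr0.
have [_ [z Hz <-] yze] := inf_lt H0 dyH.
have coord j : `|(y - z) 0 j| <= euclidean_norm (y - z).
  rewrite /euclidean_norm -sqrtr_sqr ler_wsqrtr// (bigD1 j)//= lerDl.
  by rewrite sumr_ge0// => *; rewrite sqr_ge0.
rewrite -[X in _ - X]Hz -sumrB (le_lt_trans (ler_norm_sum _ _ _))//.
apply: (@le_lt_trans _ _ ((\sum_i `|a 0 i|) * euclidean_norm (y - z))).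
  rewrite mulr_suml ler_sum// => j _; rewrite -mulrBr normrM ler_wpM2l//.
  by have := coord j; rewrite !mxE.
by rewrite ltr_pM2l.
Qed.

(** * Points whose orbit is rarely degenerate *)

Lemma negligible_of_maximal d (T : measurableType d) (R : realType)
    (mu : probability T R) (l : R) (B E : (set T)^nat) : 0 <= l ->
  (forall m, measurable (E m)) -> (forall m, (mu (E m) <= l%:E * mu (B m))%E) ->
  mu (B m) @[m --> \oo] --> 0%E -> mu.-negligible (\bigcap_m E m).
Proof.
move=> l0 mE EB B0.
have mI : measurable (\bigcap_m E m) by exact: bigcap_measurable.
apply/negligibleP => //; apply/eqP; rewrite eq_le measure_ge0 andbT.
have lB : (l%:E * mu (B m))%E @[m --> \oo] --> (l%:E * 0)%E by exact: cvgeZl.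
rewrite mule0 in lB; rewrite -(cvg_lim _ lB)//; apply: lime_ge.
  by apply/cvg_ex; eexists; exact: lB.
apply: nearW => m; apply: le_trans (EB m).
by apply: le_measure; rewrite ?inE//; exact: bigcap_inf.
Qed.

Section good_points.
Variables (R : realType) (n : nat) (F : 'I_n -> mpoly n R) (K : set 'rV[R]_n).
Variable mu : probability 'rV[R]_n R.
Hypothesis A1 : compact_invariant (vector_field F) K.
Hypothesis A2_inv : invariant_measure (vector_field F) K mu.
Hypothesis A2_ac : bounded_density K mu.
Variable Q : mpoly n R.
Hypothesis A3 : exists xstar : 'rV[R]_n, K xstar /\ meval (xstar 0) Q != 0.
Let Phi := flow (vector_field F).

(** The threshold is proportional to the step of [time_step]: the change of [Q] within one step is
    absorbed by raising [c]. *)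
Definition near_degenerate (c m : nat) : set 'rV[R]_n :=
  [set x | `|meval (x 0) Q| <= c%:R / m.+1%:R].

Lemma measurable_near_degenerate c m : measurable (near_degenerate c m).
Proof.
rewrite (_ : near_degenerate c m =
  (fun x : 'rV[R]_n => meval (x 0) Q) @^-1` `[- (c%:R / m.+1%:R), c%:R / m.+1%:R]).
  by rewrite -[X in measurable X]setTI; exact: measurable_meval.
by apply/seteqP; split=> x; rewrite /near_degenerate /= in_itv /= ler_norml.
Qed.

(** These sets decrease to the zero set of [Q], which is Lebesgue null as [Q] is nonzero somewhere,
    hence [mu]-null by the density. *)
Lemma near_degenerate_cvg0 c : mu (near_degenerate c m) @[m --> \oo] --> 0%E.
Proof.
have mK := invariant_compact_measurable A1.
have capE : \bigcap_m near_degenerate c m = [set x : 'rV[R]_n | meval (x 0) Q = 0].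
  apply/seteqP; split => [x xm|x xm m _]; last first.
    by rewrite /near_degenerate /= [meval _ _]xm normr0 divr_ge0.
  apply/eqP; rewrite -normr_eq0 eq_le normr_ge0 andbT leNgt; apply/negP => x0.
  have := xm (Num.truncn (c%:R / `|meval (x 0) Q|)) Logic.I.
  rewrite /near_degenerate /= leNgt => /negP; apply.
  by rewrite ltr_pdivrMr// mulrC -ltr_pdivrMr// truncnS_gt.
have mZ := measurable_zeros_meval Q.
have -> : 0%E = mu (\bigcap_m near_degenerate c m).
  rewrite capE; case: A2_ac => rho [c0 [C [_ mrho _ muE]]].
  rewrite muE//; apply/esym/null_set_integral.
  - exact: measurableI.
  - by apply/measurable_EFinP; apply: measurable_funS mrho.
  - apply: (subset_measure0 (B := [set x : 'rV[R]_n | meval (x 0) Q = 0])) => //.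
    + exact: measurableI.
    + by apply: lebesgue_zeros_meval; case: A3 => x [_ Qx]; exists x.
apply: (@nonincreasing_cvg_mu _ _ _ mu (near_degenerate c)).
- by rewrite (le_lt_trans (probability_le1 _ _)) ?ltry//; exact: measurable_near_degenerate.
- by move=> m; exact: measurable_near_degenerate.
- by rewrite capE.
- apply/nonincreasing_seqP => m; apply/subsetPset => x.
  rewrite /near_degenerate /= => /le_trans; apply; apply: ler_wpM2l => //.
  by rewrite lef_pV2 ?posrE ?ltr0n// ler_nat.
Qed.

(** The identity off [K] makes this a measurable map of the whole space preserving [mu], as the
    maximal inequality requires. *)
Definition time_step (m : nat) (x : 'rV[R]_n) : 'rV[R]_n :=
  if x \in K then Phi m.+1%:R^-1 x else x.

Lemma time_step_preimage m A :
  time_step m @^-1` A = (K `&` Phi m.+1%:R^-1 @^-1` A) `|` (~` K `&` A).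
Proof.
apply/seteqP; split => x; rewrite /time_step /=.
  by case: ifPn => [/set_mem Kx Ax|/negP xK Ax]; [left|right; split=> // /mem_set].
by case: ifPn => [/set_mem Kx [[_ //]|[//]]|/negP xK [[/mem_set//]|[]]].
Qed.

Lemma measurable_time_step m : measurable_fun [set: 'rV[R]_n] (time_step m).
Proof.
move=> _ A mA; rewrite setTI time_step_preimage.
have mK := invariant_compact_measurable A1.
apply: measurableU; last by apply: measurableI => //; exact: measurableC.
exact: measurable_flow.
Qed.

Lemma time_step_preserving m A : measurable A -> mu (time_step m @^-1` A) = mu A.
Proof.
move=> mA; have mK := invariant_compact_measurable A1; have [muK inv] := A2_inv.
have mKA : measurable (K `&` Phi m.+1%:R^-1 @^-1` A) by exact: measurable_flow.
have mKC : measurable (~` K) by exact: measurableC.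
rewrite time_step_preimage measureU//; last 2 first.
- exact: measurableI.
- by rewrite -subset0 => x [[Kx _] [/(_ Kx)]].
rewrite [X in (_ + X)%E](_ : _ = 0%E); last first.
  apply: (subset_measure0 (B := ~` K)) => //; first exact: measurableI.
  by rewrite [LHS]probability_setC// [X in (1 - X)%E]muK subee.
by rewrite adde0; exact: inv.
Qed.

Lemma iter_time_step m j x : K x -> iter j (time_step m) x = Phi (j%:R / m.+1%:R) x.
Proof.
move=> Kx; elim: j => [|j IHj]; first by rewrite mul0r /Phi (flow0 A1).
rewrite iterS IHj /time_step mem_set; last exact: (flow_in A1).
by rewrite /Phi -(flow_add A1)// -(@natr1 R j) mulrDl mul1r.
Qed.

(** Division-free form of a visit frequency that is eventually at most [1 / l]. *)
Definition rarely_visiting (c l m : nat) : set 'rV[R]_n :=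
  [set x | exists N0, forall N, (N0 <= N)%N ->
    (l * visit_count (time_step m) (near_degenerate c m) N x <= N)%N].

Lemma measurable_visit m c N : measurable_fun [set: 'rV[R]_n]
  (fun x => (visit_count (time_step m) (near_degenerate c m) N x)%:R : R).
Proof.
rewrite /visit_count; under eq_fun do rewrite natr_sum.
apply: measurable_sum => j.
have mT : measurable_fun [set: 'rV[R]_n] (iter j (time_step m)).
  elim: (nat_of_ord j) => [|i IHi]; first exact: measurable_id.
  by apply: measurableT_comp IHi; exact: measurable_time_step.
rewrite (_ : (fun x => _) = \1_(near_degenerate c m) \o iter j (time_step m)).
  by apply: measurableT_comp mT; apply: measurable_indic; exact: measurable_near_degenerate.
apply/funext => x /=; rewrite indicE; congr ((nat_of_bool _)%:R).
Qed.

Lemma measurable_rarely_visiting c l m : measurable (rarely_visiting c l m).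
Proof.
rewrite (_ : rarely_visiting c l m = \bigcup_N0 \bigcap_(N in [set N | (N0 <= N)%N])
  [set x | (l * visit_count (time_step m) (near_degenerate c m) N x <= N)%N]); last first.
  by apply/seteqP; split=> x [N0]; [exists N0|move=> _ H; exists N0].
apply: bigcup_measurable => N0 _; apply: bigcap_measurable => [|N _].
  by exists N0 => /=.
rewrite (_ : [set x | _] = (fun x => l%:R * (visit_count (time_step m)
    (near_degenerate c m) N x)%:R : R) @^-1` `]-oo, N%:R]).
  rewrite -[X in measurable X]setTI.
  apply: measurable_funM => //; exact: measurable_visit.
by apply/seteqP; split=> x /=; rewrite in_itv /= -natrM ler_nat.
Qed.

(** The time step may depend on [c] and [l]. All indices are countable, which gives
    measurability. *)
Definition good_points : set 'rV[R]_n :=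
  K `&` \bigcap_c \bigcap_l \bigcup_m rarely_visiting c l m.

Lemma measurable_good_points : measurable good_points.
Proof.
apply: measurableI; first exact: invariant_compact_measurable A1.
apply: bigcap_measurable => // c _; apply: bigcap_measurable => // l _.
by apply: bigcup_measurable => m _; exact: measurable_rarely_visiting.
Qed.

(** A point outside the union lies in the exceptional set of the maximal inequality for every [m],
    and the measures of these sets tend to 0. *)
Lemma rarely_visiting_full c l :
  mu.-negligible (~` (\bigcup_m rarely_visiting c l m)).
Proof.
have H m := visit_maximal_inequality (measurable_time_step m)
  (time_step_preserving m) (measurable_near_degenerate c m) (ler0n R l).
have [E EP] := choice H.
apply: (negligibleS _ (@negligible_of_maximal _ _ _ mu l%:R (near_degenerate c) E
  (ler0n R l) _ _ _)).
- move=> x; rewrite setC_bigcup => xG m _.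
  apply: contrapT => Ex; apply: (xG m Logic.I); exists 0%N => N _.
  have [_ _ /(_ x Ex N)] := EP m.
  by rewrite -natrM ler_nat.
- by move=> m; have [] := EP m.
- by move=> m; have [] := EP m.
- exact: near_degenerate_cvg0.
Qed.

Lemma good_points_full : mu good_points = 1%E.
Proof.
have mX := measurable_good_points; have mK := invariant_compact_measurable A1.
have : mu.-negligible (~` good_points).
  rewrite /good_points setCI; apply: negligibleU.
    apply/negligibleP; first exact: measurableC.
    by rewrite [LHS]probability_setC// [X in (1 - X)%E](A2_inv.1) subee.
  rewrite setC_bigcap; apply: negligible_bigcup => c; rewrite setC_bigcap.
  by apply: negligible_bigcup => l; exact: rarely_visiting_full.
move/negligibleP => /(_ (measurableC mX)) X0.
by rewrite -[good_points]setCK [LHS]probability_setC ?[X in (1 - X)%E]X0 ?sube0//;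
  exact: measurableC.
Qed.

End good_points.

(** * Time spent near a hyperplane *)

(** One [eps] must serve all orders up to [n], because which derivative is large varies along the
    orbit. *)
Lemma sublevel_measure_fin (R : realType) (n : nat) (eta kappa : R) :
  0 < eta -> 0 < kappa ->
  exists2 eps : R, 0 < eps & forall k (h : nat -> R -> R) (I : set R),
    (k <= n)%N -> is_interval I ->
    (forall i t, I t -> is_derive t 1 (h i) (h i.+1 t)) ->
    (forall t, I t -> eta <= `|h k t|) ->
    (lebesgue_measure (I `&` [set t | (`|h 0%N t| < eps)%R]) <= kappa%:E)%E.
Proof.
move=> eta0 kappa0; elim: n => [|n [e1 e10 H1]].
  have [eps eps0 H] := sublevel_measure 0 eta0 kappa0.
  by exists eps => // k h I; rewrite leqn0 => /eqP ->; exact: H.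
have [e2 e20 H2] := sublevel_measure n.+1 eta0 kappa0.
exists (Num.min e1 e2) => [|k h I kn II dh hk]; first by rewrite lt_min e10.
have mI := is_interval_measurable II.
have le_eps e : Num.min e1 e2 <= e ->
    (lebesgue_measure (I `&` [set t | (`|h 0%N t| < Num.min e1 e2)%R]) <=
     lebesgue_measure (I `&` [set t | (`|h 0%N t| < e)%R]))%E.
  move=> ee; apply: le_measure; rewrite ?inE.
  - exact: (@measurable_sublevel _ (h 0%N) (h 1%N) _ _ mI (dh 0%N)).
  - exact: (@measurable_sublevel _ (h 0%N) (h 1%N) _ _ mI (dh 0%N)).
  - by move=> t [It /= ht]; split=> //=; exact: lt_le_trans ht ee.
move: kn hk; rewrite leq_eqVlt => /predU1P[->|kn] hk.
  by apply: le_trans (le_eps e2 _) (H2 h I II dh hk); rewrite ge_min lexx orbT.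
by apply: le_trans (le_eps e1 _) (H1 k h I kn II dh hk); rewrite ge_min lexx.
Qed.

Lemma lebesgue_blocks_le (R : realType) (S : set R) (a w : R) (f : nat -> R) (N : nat) :
  measurable S -> 0 <= w ->
  (forall i, (i < N)%N -> (lebesgue_measure
     (`[(a + i%:R * w)%R, (a + i%:R * w + w)%R] `&` S) <= (f i)%:E)%E) ->
  (lebesgue_measure (`[a, (a + N%:R * w)%R] `&` S) <= (\sum_(i < N) f i)%:E)%E.
Proof.
move=> mS w0; elim: N => [|N IHN] Hf.
  rewrite mul0r addr0 big_ord0 set_itv1.
  apply: (@le_trans _ _ (lebesgue_measure [set a])).
    by apply: le_measure; rewrite ?inE//; exact: measurableI.
  by rewrite lebesgue_measure_set1.
have cover : `[a, a + N.+1%:R * w] `&` S `<=`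
    (`[a, a + N%:R * w] `&` S) `|` (`[a + N%:R * w, a + N%:R * w + w] `&` S).
  move=> t [+ St]; rewrite /= in_itv /= -natr1 mulrDl mul1r addrA => /andP[ta tb].
  have [tN|/ltW tN] := leP t (a + N%:R * w); [left|right]; split=> //=;
  by rewrite in_itv /= ?ta ?tN.
apply: (@le_trans _ _ (lebesgue_measure ((`[a, a + N%:R * w] `&` S) `|`
    (`[a + N%:R * w, a + N%:R * w + w] `&` S)))).
  apply: le_measure; rewrite ?inE//; first exact: measurableI.
  by apply: measurableU; apply: measurableI.
rewrite big_ord_recr EFinD /=; apply: (@le_trans _ _
  (lebesgue_measure (`[a, (a + N%:R * w)%R] `&` S) +
   lebesgue_measure (`[(a + N%:R * w)%R, (a + N%:R * w + w)%R] `&` S))%E).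
  by apply: measureU2; apply: measurableI.
by apply: leeD; [apply: IHN => i iN; apply: Hf; exact: ltnW|exact: Hf].
Qed.

(** * Variation of polynomials along orbits *)

Section along_flow.
Variables (R : realType) (n : nat) (F : 'I_n -> mpoly n R) (K : set 'rV[R]_n).
Hypothesis A1 : compact_invariant (vector_field F) K.
Let Phi := flow (vector_field F).

(** The time derivative is the Lie derivative of [P], bounded on [K]; the mean value theorem gives a
    constant uniform in the orbit and in time. *)
Lemma lipschitz_along_flow (P : mpoly n R) : exists2 L : R, 0 <= L &
  forall x s t, K x ->
    `|meval (Phi t x 0) P - meval (Phi s x 0) P| <= L * `|t - s|.
Proof.
have [r Kr] := compact_in_box A1.
have [C C0 CP] := meval_lipschitz (lie_poly F P) r.
exists C => // x s t Kx; wlog st : s t / s <= t => [WL|].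
  by have [/WL//|/ltW/WL] := leP s t; rewrite distrC (distrC s t).
have dP (u : R) : setT u -> is_derive u 1 (fun v => meval (Phi v x 0) P)
    (meval (Phi u x 0) (lie_poly F P)).
  by move=> _; apply: is_derive_meval => i; exact: (is_derive_flow A1).
have IT : is_interval [set: R] by [].
have [c _ ->] := mean_value_interval IT dP Logic.I Logic.I st.
rewrite normrM ler_wpM2r//.
by have [] := CP _ _ (Kr _ (flow_in A1 c Kx)) (Kr _ (flow_in A1 c Kx)).
Qed.

Lemma lipschitz_along_flow_fin (m : nat) (P : 'I_m -> mpoly n R) :
  exists2 L : R, 0 <= L & forall k x s t, K x ->
    `|meval (Phi t x 0) (P k) - meval (Phi s x 0) (P k)| <= L * `|t - s|.
Proof.
have [L L0 LP] := fin_all_exists2 (fun k => lipschitz_along_flow (P k)).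
exists (\sum_k L k) => [|k x s t Kx]; first by rewrite sumr_ge0.
by rewrite (le_trans (LP k x s t Kx))// ler_wpM2r// (bigD1 k)//= lerDl sumr_ge0.
Qed.

(** A positive integer constant can be added to the index [c] of [near_degenerate]. *)
Lemma lipschitz_along_flow_nat (P : mpoly n R) : exists L : nat,
  forall x s t, K x ->
    `|meval (Phi t x 0) P - meval (Phi s x 0) P| <= L.+1%:R * `|t - s|.
Proof.
have [L L0 LP] := lipschitz_along_flow P.
exists (Num.truncn L) => x s t Kx; rewrite (le_trans (LP x s t Kx))// ler_wpM2r//.
by rewrite ltW// truncnS_gt.
Qed.

Lemma visit_count_flow (Q : mpoly n R) c m N x : K x ->
  visit_count (time_step F K m) (near_degenerate Q c m) N x =
  (\sum_(j < N)
    ((`|meval (Phi (j%:R / m.+1%:R) x 0) Q| <= c%:R / m.+1%:R)%R : bool))%N.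
Proof.
move=> Kx; rewrite /visit_count; apply: eq_bigr => j _; rewrite (iter_time_step A1)//.
by congr nat_of_bool; apply/asboolP/idP.
Qed.

End along_flow.

(** Shifting an index window by [p], in either direction, costs at most [p] visits. *)
Lemma visits_shift (a b : nat -> bool) (p N : nat) :
  (forall j, a j -> b (j + p)%N) \/ (forall j, a (j + p)%N -> b j) ->
  (\sum_(j < N) a j <= p + \sum_(j < N + p) b j)%N.
Proof.
have cut (e : nat -> bool) : (\sum_(j < N + p) e j = \sum_(j < p) e j + \sum_(j < N) e (j + p))%N.
  rewrite -(big_mkord xpredT (fun j => e j : nat)) (@big_cat_nat _ _ _ p)//=; last exact: leq_addl.
  rewrite big_mkord; congr (_ + _)%N.
  by rewrite -{1}[p]add0n big_addn addnK big_mkord.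
have le1 (x y : bool) : (x -> y) -> (x <= y)%N by case: x y => -[] // /(_ isT).
case=> ab.
  rewrite cut addnA (leq_trans _ (leq_addl _ _))//.
  by apply: leq_sum => j _; apply: le1; exact: ab.
apply: (@leq_trans (\sum_(j < N + p) a j)).
  by rewrite big_split_ord /= leq_addr.
rewrite cut leq_add//.
  rewrite -[X in (_ <= X)%N]card_ord -sum1_card leq_sum// => j _.
  by case: (a j).
apply: (@leq_trans (\sum_(j < N) b j)); last by rewrite big_split_ord /= leq_addr.
by apply: leq_sum => j _; apply: le1; exact: ab.
Qed.

(** * Invariance of the good points *)

Section main_estimate.
Variables (R : realType) (n : nat) (F : 'I_n -> mpoly n R) (K : set 'rV[R]_n).
Hypothesis A1 : compact_invariant (vector_field F) K.
Let Phi := flow (vector_field F).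

(** Write [s] as [q * tau] plus a remainder below [tau]. The integer part shifts the visit times,
    and the remainder changes [Q] by at most [L.+1 * tau]. *)
Lemma good_points_invariant (Q : mpoly n R) :
  flow_invariant (vector_field F) (good_points F K Q).
Proof.
move=> s _ [x [Kx xG] <-]; split; first exact: (flow_in A1).
move=> c _ l _.
have [L LP] := lipschitz_along_flow_nat A1 Q.
(* [c + L.+1] pays for the remainder of [s]; [2 * l] leaves room for the visits lost to the
   shift. *)
have [m _ [N0 HN0]] := xG (c + L.+1)%N Logic.I (2 * l)%N Logic.I.
pose tau : R := m.+1%:R^-1.
have tau0 : 0 < tau by rewrite invr_gt0.
pose q := Num.floor (s / tau).
have /andP[q1 q2] : q%:~R * tau <= s < q%:~R * tau + tau.
  have := floor_itv (s / tau); rewrite -/q ler_pdivlMr// ltr_pdivrMr//.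
  by rewrite intrD mulrDl mul1r.
have shift (j j' : nat) : (j'%:R = j%:R + q%:~R :> R) ->
    `|meval (Phi (j%:R / m.+1%:R) (Phi s x) 0) Q| <= c%:R / m.+1%:R ->
    `|meval (Phi (j'%:R / m.+1%:R) x 0) Q| <= (c + L.+1)%:R / m.+1%:R.
  move=> jj'; rewrite /Phi -(flow_add A1)// => Qj.
  have := LP x (s + j%:R / m.+1%:R) (j'%:R / m.+1%:R) Kx.
  rewrite jj' -/tau => LQ.
  have d : `|(j%:R + q%:~R) * tau - (s + j%:R * tau)| <= tau.
    by rewrite mulrDl ler_norml; apply/andP; split; lra.
  have {}LQ := le_trans LQ (ler_wpM2l (ler0n R L.+1) d).
  rewrite natrD -/tau; move: Qj; rewrite -/tau => Qj.
  rewrite -[X in `|X|](subrK (meval (flow (vector_field F) (s + j%:R * tau) x 0) Q)).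
  by rewrite (le_trans (ler_normD _ _))// [leRHS]mulrDl [leRHS]addrC lerD//.
pose p := `|q|%N.
(* The shift yields [2 * l * va <= 2 * l * p + (N + p)], which is at most [2 * N] for such [N]. *)
exists m => //; exists (N0 + (2 * l * p + p))%N => N hN.
pose a j := `|meval (Phi (j%:R / m.+1%:R) (Phi s x) 0) Q| <= c%:R / m.+1%:R.
pose b j := `|meval (Phi (j%:R / m.+1%:R) x 0) Q| <= (c + L.+1)%:R / m.+1%:R.
have ab : (forall j, a j -> b (j + p)%N) \/ (forall j, a (j + p)%N -> b j).
  have [q0|q0] := leP 0 q; [left|right] => j; apply: shift.
    by rewrite natrD /p natr_absz ger0_norm.
  by rewrite natrD /p natr_absz ltr0_norm// mulrNz subrK.
have := HN0 (N + p)%N; rewrite (visit_count_flow A1)//.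
rewrite (visit_count_flow A1); last exact: (flow_in A1).
have := visits_shift N ab; rewrite /a /b /Phi.
set va := \sum_(j < N) _; set vb := \sum_(j < N + p) _ => vab.
have hN' : (N0 <= N + p)%N.
  by rewrite (leq_trans _ (leq_addr _ _))// (leq_trans _ hN)// leq_addr.
move=> /(_ hN') vbN.
have [l0|l0] := posnP l; first by rewrite l0.
have : (2 * (l * va) <= 2 * N)%N; last by rewrite leq_pmul2l.
rewrite mulnA (leq_trans (leq_mul (leqnn (2 * l)) vab))// mulnDr.
rewrite (leq_trans (leq_add (leqnn _) vbN))// [(N + p)%N]addnC addnA.
by rewrite [X in (_ <= X)%N]mul2n -addnn leq_add2r (leq_trans _ hN)// leq_addl.
Qed.

End main_estimate.

(** * Occupation time of a slab along a good orbit *)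

Section occupation_time.
Variables (R : realType) (n : nat) (F : 'I_n -> mpoly n R) (K : set 'rV[R]_n).
Hypothesis A1 : compact_invariant (vector_field F) K.
Let Phi := flow (vector_field F).

(** Cut time into blocks of length [tau]. Blocks starting near the zero set of [Q] are rare and
    count in full; every other block contributes at most [tau / l]. Each kind adds at most
    [N * tau / l], and [N * tau <= 2 * T]. *)
Lemma occupation_time_le x (a : 'rV[R]_n) b (l : nat) :
  good_points F K (lie_det F) x -> a != 0 -> (0 < l)%N ->
  exists2 eps : R, 0 < eps & exists2 T0 : R, 0 < T0 & forall T, T0 <= T ->
    (lebesgue_measure (`[0%R, T] `&`
      [set t | (`|meval (Phi t x 0) (affine_poly a b)| < eps)%R]) <=
     (4 * T / l%:R)%:E)%E.
Proof.
move=> [Kx xG] a0 l0; pose Q := lie_det F.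
have [r Kr] := compact_in_box A1.
have [L LP] := lipschitz_along_flow_nat A1 Q.
(* A block starting with [|Q|] above [2 * L.+1 * tau] keeps [|Q|] at least [L.+1 * tau]
   throughout. *)
have [m _ [N0 HN0]] := xG (2 * L.+1)%N Logic.I l Logic.I.
pose tau : R := m.+1%:R^-1.
have tau0 : 0 < tau by rewrite invr_gt0.
have Ltau0 : 0 < L.+1%:R * tau by rewrite mulr_gt0.
have l0R : 0 < l%:R :> R by rewrite ltr0n.
have [eta eta0 Heta] := lie_det_nondegenerate F b Kr Ltau0 a0.
pose h k t := meval (Phi t x 0) (iter k (lie_poly F) (affine_poly a b)).
have dh k (t : R) : is_derive t 1 (h k) (h k.+1 t).
  by apply: is_derive_meval => i; exact: (is_derive_flow A1).
have [L' L'0 L'P] := lipschitz_along_flow_fin A1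
  (fun k : 'I_n => iter k.+1 (lie_poly F) (affine_poly a b)).
(* Blocks are split into [p.+1] pieces, so short that no derivative of order 1 to [n] changes by
   more than [eta / 2] on a piece: the one that is large at its start stays above [eta / 2]. *)
pose p := Num.truncn (L' * tau / (eta / 2)).
pose sigma := tau / p.+1%:R.
have sigma0 : 0 < sigma by rewrite divr_gt0.
have L'sigma : L' * sigma <= eta / 2.
  rewrite /sigma mulrA ler_pdivrMr// [leRHS]mulrC -ler_pdivrMr ?divr_gt0//.
  by rewrite ltW// truncnS_gt.
(* The [p.+1] pieces of a block add up to [tau / l]. *)
pose kappa := tau / l%:R / p.+1%:R.
have kappa0 : 0 < kappa by rewrite !divr_gt0.
have eta20 : 0 < eta / 2 by rewrite divr_gt0.
have [eps eps0 Heps] := sublevel_measure_fin n eta20 kappa0.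
pose S := [set t | `|h 0%N t| < eps].
have mS : measurable S.
  rewrite -[S]setTI.
  exact: (@measurable_sublevel _ (h 0%N) (h 1%N) _ eps measurableT (fun t _ => dh 0%N t)).
have small u : L.+1%:R * tau <= `|meval (Phi u x 0) Q| ->
    (lebesgue_measure (`[u, (u + sigma)%R] `&` S) <= kappa%:E)%E.
  move=> /(Heta _ (flow_in A1 u Kx))[k Hk].
  have := Heps k.+1 h [set` `[u, u + sigma]] (ltn_ord k)
    (@interval_is_interval _ `[u, u + sigma]) (fun i t _ => dh i t).
  apply=> t; rewrite /= in_itv /= => /andP[ut tu].
  have := L'P k x u t Kx; rewrite [`|t - u|]ger0_norm ?subr_ge0// => Lt.
  have {}Lt : `|h k.+1 t - h k.+1 u| <= eta / 2.
    rewrite (le_trans Lt)// (le_trans _ L'sigma)// ler_wpM2l//.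
    by rewrite lerBlDl.
  have := lerB_dist (h k.+1 u) (h k.+1 t); rewrite distrC.
  move: Hk; rewrite -/(h k.+1 u); lra.
pose v j := (`|meval (Phi (j%:R / m.+1%:R) x 0) Q| <= (2 * L.+1)%:R / m.+1%:R) : bool.
have block j : (lebesgue_measure (`[(0 + j%:R * tau)%R, (0 + j%:R * tau + tau)%R]
    `&` S) <= (tau * (v j)%:R + tau / l%:R)%:E)%E.
  rewrite add0r; case: (boolP (v j)) => [_|vj].
    apply: (@le_trans _ _ (lebesgue_measure `[j%:R * tau, j%:R * tau + tau])).
      by apply: le_measure; rewrite ?inE//; exact: measurableI.
    rewrite lebesgue_measure_itv /= lte_fin ltrDl tau0 -EFinD lee_fin addrC addKr.
    by rewrite mulr1 lerDl divr_ge0// ltW.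
  have psigma : p.+1%:R * sigma = tau by rewrite mulrC divfK// pnatr_eq0.
  have := @lebesgue_blocks_le R S (j%:R * tau) sigma (fun=> kappa) p.+1 mS (ltW sigma0).
  rewrite psigma sumr_const card_ord -[kappa *+ _]mulr_natl [_ * kappa]mulrC.
  rewrite /kappa divfK ?pnatr_eq0// mulr0 add0r; apply.
  move=> i ip; apply: small; move: vj; rewrite /v -ltNge => vj.
    have := LP x (j%:R * tau + i%:R * sigma) (j%:R / m.+1%:R) Kx.
    have := lerB_dist (meval (Phi (j%:R / m.+1%:R) x 0) Q)
      (meval (Phi (j%:R * tau + i%:R * sigma) x 0) Q).
    rewrite distrC; have -> : j%:R / m.+1%:R - (j%:R * tau + i%:R * sigma) =
      - (i%:R * sigma) by rewrite /tau; ring.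
    have is0 : 0 <= i%:R * sigma by rewrite mulr_ge0// ltW.
    rewrite normrN (ger0_norm is0).
    have isig : L.+1%:R * (i%:R * sigma) <= L.+1%:R * tau.
      by rewrite ler_wpM2l// -psigma ler_wpM2r ?(ltW sigma0)// ler_nat ltnW.
    by move: vj; rewrite natrM -/tau; lra.
(* [T >= tau] makes rounding up to whole blocks at most double [T]; [T >= N0 * tau] makes the visit
   bound available. *)
exists eps => //; exists (Num.max tau (N0%:R * tau)).
  by rewrite lt_max tau0.
move=> T; rewrite ge_max => /andP[Ttau TN0].
pose N := (Num.truncn (T / tau)).+1.
have T0 : 0 <= T by rewrite (le_trans (ltW tau0)).
have TN : T <= N%:R * tau by rewrite -ler_pdivrMr// ltW// truncnS_gt.
have NT : N%:R * tau <= T *+ 2.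
  rewrite /N -natr1 mulrDl mul1r mulr2n lerD// -ler_pdivlMr//.
  by rewrite truncn_le divr_ge0// ltW.
have N0N : (N0 <= N)%N.
  by rewrite -(ler_nat R) -(ler_pM2r tau0) (le_trans TN0).
apply: (@le_trans _ _ (lebesgue_measure (`[0%R, (0 + N%:R * tau)%R] `&` S))).
  apply: le_measure; rewrite ?inE.
  - exact: measurableI.
  - exact: measurableI.
  - move=> t [+ St]; rewrite /= !in_itv /= => /andP[t0 tT]; split=> //.
    by rewrite t0 add0r (le_trans tT).
have Hblock := @lebesgue_blocks_le R S 0 tau _ N mS (ltW tau0) (fun j _ => block j).
apply: (le_trans Hblock).
rewrite lee_fin big_split /= -mulr_sumr -natr_sum sumr_const card_ord.
have := HN0 N N0N; rewrite (visit_count_flow A1)// -/Q.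
set cnt := (\sum_(j < N) _)%N => cntN.
have {}cntN : cnt%:R <= N%:R / l%:R :> R.
  by rewrite ler_pdivlMr// -natrM ler_nat mulnC.
apply: (@le_trans _ _ (tau * (N%:R / l%:R) + (tau / l%:R) *+ N)).
  by rewrite lerD2r ler_wpM2l// ltW.
rewrite -[(tau / l%:R) *+ N]mulr_natl.
have -> : tau * (N%:R / l%:R) + N%:R * (tau / l%:R) = 2 * (N%:R * tau) / l%:R.
  by ring.
by rewrite ler_wpM2r ?invr_ge0 ?(ltW l0R)//; lra.
Qed.

End occupation_time.

(** * Time averages and their limits *)

Lemma ge0_le_integral_nonmeasurable d (T : measurableType d) (R : realType)
    (mu : {measure set T -> \bar R}) (D : set T) (f g : T -> \bar R) :
  (forall x, D x -> 0 <= f x)%E -> (forall x, D x -> f x <= g x)%E ->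
  (\int[mu]_(x in D) f x <= \int[mu]_(x in D) g x)%E.
Proof.
move=> f0 fg; have g0 x : D x -> (0 <= g x)%E.
  by move=> Dx; rewrite (le_trans (f0 x Dx))// fg.
(* The integral of a nonnegative function is a supremum over simple functions below it, so it is
   monotone whether or not the function is measurable. *)
rewrite !ge0_integralE//; apply: ereal_sup_le => _ [k /= kf <-]; exists k => //= x.
by apply: le_trans (kf x) _; exact: lee_restrict.
Qed.

Section time_average_bounds.
Variables (R : realType) (n : nat) (f : 'rV[R]_n -> 'rV[R]_n) (x : 'rV[R]_n).

Lemma time_average_ge0 (A : set 'rV[R]_n) (T : R) : 0 <= T ->
  (0 <= time_average f x A T)%E.
Proof.
move=> T0; rewrite /time_average mule_ge0 ?lee_fin ?invr_ge0//.
by apply: integral_ge0 => t _; rewrite lee_fin indicE ler0n.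
Qed.

Lemma time_average_le (A : set 'rV[R]_n) (S : set R) (M T : R) :
  0 < T -> measurable S -> (forall t, A (flow f t x) -> S t) ->
  (lebesgue_measure (`[0%R, T] `&` S) <= (M * T)%:E)%E ->
  (time_average f x A T <= M%:E)%E.
Proof.
move=> T0 mS AS ST; rewrite /time_average.
apply: (@le_trans _ _ (T^-1%:E * (M * T)%:E)%E); last first.
  by rewrite -EFinM lee_fin mulrCA mulVf ?gt_eqF// mulr1.
apply: lee_wpmul2l; first by rewrite lee_fin invr_ge0 ltW.
apply: le_trans ST; rewrite setIC -integral_indic//.
apply: ge0_le_integral_nonmeasurable => t _; first by rewrite lee_fin indicE ler0n.
rewrite lee_fin !indicE ler_nat; case: (boolP (_ \in A)) => // /set_mem /AS St.
by rewrite mem_set.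
Qed.

End time_average_bounds.

Lemma limf_esup_pinfty_le (R : realType) (g : R -> \bar R) (M : \bar R) (T0 : R) :
  (forall T, T0 <= T -> (g T <= M)%E) -> (limf_esup g (pinfty_nbhs R) <= M)%E.
Proof.
move=> gM; rewrite /limf_esup.
apply: (@le_trans _ _ (ereal_sup (g @` [set T | T0 <= T]))).
  apply: ereal_inf_lbound; exists [set T | T0 <= T] => //.
  by apply: nbhs_pinfty_ge; exact: num_real.
by apply: ge_ereal_sup => _ [T T0T <-]; exact: gM.
Qed.

Lemma limf_esup_pinfty_ge (R : realType) (g : R -> \bar R) (M : \bar R) (T0 : R) :
  (forall T, T0 <= T -> (M <= g T)%E) -> (M <= limf_esup g (pinfty_nbhs R))%E.
Proof.
move=> gM; rewrite /limf_esup; apply: le_ereal_inf_tmp => _ [V VF <-].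
have [T [VT T0T]] : (V `&` [set T | T0 <= T]) !=set0.
  apply: (@filter_ex _ (pinfty_nbhs R)); apply: filterI.
    exact: VF.
  exact: nbhs_pinfty_ge (num_real _).
by apply: le_ereal_sup_tmp; exists (g T); [exists T|exact: gM].
Qed.

(** The bounds also make [g] finite near 0, so convergence can be checked on real values. *)
Lemma cvg0_at_right (R : realType) (g : R -> \bar R) :
  (forall e, (0 <= g e)%E) ->
  (forall lam : R, 0 < lam ->
    exists2 d, 0 < d & forall e, 0 < e -> e < d -> (g e <= lam%:E)%E) ->
  g e @[e --> 0^'+] --> 0%E.
Proof.
move=> g0 glam.
have near_le lam : 0 < lam -> \forall e \near 0^'+, (g e <= lam%:E)%E.
  move=> /glam[d d0 gd]; near=> e; apply: gd; near: e.
    exact: nbhs_right_gt.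
  exact: nbhs_right_lt.
apply/fine_cvgP; split.
  apply: filterS (near_le 1 ltr01) => e ge1.
  by rewrite ge0_fin_numE// (le_lt_trans ge1)// ltry.
apply/cvgrPdist_le => lam lam0; apply: filterS (near_le lam lam0) => e gle.
have gfin : g e \is a fin_num by rewrite ge0_fin_numE// (le_lt_trans gle)// ltry.
by rewrite sub0r normrN ger0_norm ?fine_ge0//= -lee_fin fineK.
Unshelve. all: by end_near. Qed.

Theorem theorem4 (R : realType) (n : nat) (F : 'I_n -> mpoly n R)
    (K : set 'rV[R]_n) (mu : probability 'rV[R]_n R)
    (A1 : compact_invariant (vector_field F) K)
    (A2_inv : invariant_measure (vector_field F) K mu)
    (A2_ac : bounded_density K mu)
    (A3 : exists xstar : 'rV[R]_n,
        K xstar /\ meval (xstar 0) (lie_det F) != 0) :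
  exists X0 : set 'rV[R]_n,
    [/\ measurable X0, X0 `<=` K, flow_invariant (vector_field F) X0,
        mu X0 = 1%E &
        forall (x : 'rV[R]_n) (H : set 'rV[R]_n),
          X0 x -> is_affine_hyperplane H ->
          limf_esup (time_average (vector_field F) x (neighborhood_in K H eps))
            (pinfty_nbhs R) @[eps --> 0^'+] --> 0%E].
Proof.
exists (good_points F K (lie_det F)); split.
- exact: measurable_good_points.
- by move=> x [].
- exact: good_points_invariant.
- exact: good_points_full.
move=> x _ X0x [a [b [a0 ->]]]; apply: cvg0_at_right => [e|lam lam0].
  apply: (@limf_esup_pinfty_ge _ _ _ 0) => T T0; exact: time_average_ge0.
(* Ensures [4 / l <= lam]. *)
pose l := (Num.truncn (4 / lam)).+1.
have [eps eps0 [T0 T00 HT]] := occupation_time_le A1 b X0x a0 (ltn0Sn _ : (0 < l)%N).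
have A0 : 0 < \sum_i `|a 0 i|.
  rewrite lt_neqAle sumr_ge0// andbT eq_sym; apply/eqP => sum0.
  move/eqP: a0; apply; apply/rowP => i; rewrite mxE; apply/eqP.
  by rewrite -normr_le0 -sum0 (bigD1 i)//= lerDl sumr_ge0.
(* Within distance [e] of the hyperplane the affine function is below [e] times the sum of the
   [|a 0 i|], hence below [eps]. *)
exists (eps / \sum_i `|a 0 i|); first exact: divr_gt0.
move=> e e0; rewrite ltr_pdivlMr// mulrC => eeps.
apply: (@limf_esup_pinfty_le _ _ _ T0) => T T0T.
have T_gt0 : 0 < T := lt_le_trans T00 T0T.
apply: (@time_average_le _ _ _ _ _
  [set t | `|meval (flow (vector_field F) t x 0) (affine_poly a b)| < eps]) => //.
- rewrite -[X in measurable X]setTI.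
  apply: (@measurable_sublevel _ _
    (fun t => meval (flow (vector_field F) t x 0) (lie_poly F (affine_poly a b)))).
    exact: measurableT.
  move=> t _; apply: is_derive_meval => i.
  by case: X0x => Kx _; exact: (is_derive_flow A1).
- move=> t [_ yH] /=; rewrite meval_affine_poly.
  by apply: lt_trans eeps; exact: hyperplane_neighborhood.
- apply: (le_trans (HT T T0T)); rewrite lee_fin mulrAC ler_wpM2r ?(ltW T_gt0)//.
  by rewrite ler_pdivrMr// [leRHS]mulrC -ler_pdivrMr// ltW// truncnS_gt.
Qed.
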